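(* Let $\mathcal X$ be a complete separable metric space, $K$ a continuous positive definite kernel on $\mathcal X\times\mathcal X$ with RKHS $\mathcal H_K$ and feature map $\Phi$. Let $\mathbf X=[x_1,\dots,x_m]$, $\mathbf Y=[y_1,\dots,y_m]$ be points in $\mathcal X$, with Gram matrices $K[\mathbf X]_{ij}=K(x_i,x_j)$, $K[\mathbf Y]_{ij}=K(y_i,y_j)$, $K[\mathbf X,\mathbf Y]_{ij}=K(x_i,y_j)$, $K[\mathbf Y,\mathbf X]=K[\mathbf X,\mathbf Y]^T$. Let $J_m=I_m-\frac1m\mathbf 1_m\mathbf 1_m^T$, and define the empirical mean and covariance $\mu_{\Phi(\mathbf X)}=\frac1m\sum_j\Phi(x_j)$, $C_{\Phi(\mathbf X)}=\frac1m\Phi(\mathbf X)J_m\Phi(\mathbf X)^*$ (similarly for $\mathbf Y$), where $\Phi(\mathbf X):\mathbb R^m\to\mathcal H_K$, $b\mapsto\sum_jb_j\Phi(x_j)$. Let $\mu_0=\mathcal N(\mu_{\Phi(\mathbf X)},C_{\Phi(\mathbf X)})$, $\mu_1=\mathcal N(\mu_{\Phi(\mathbf Y)},C_{\Phi(\mathbf Y)})$ on $\mathcal H_K$, $\epsilon>0$, and write $P=J_mK[\mathbf X,\mathbf Y]J_mK[\mathbf Y,\mathbf X]J_m$, $c=\frac{16}{\epsilon^2m^2}$. Then $$\mathrm{OT}^\epsilon_{d^2}(\mu_0,\mu_1)=\tfrac1{m^2}\mathbf 1_m^T(K[\mathbf X]+K[\mathbf Y]-2K[\mathbf X,\mathbf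 Y])\mathbf 1_m+\tfrac1m\mathrm{Tr}(K[\mathbf X]J_m)+\tfrac1m\mathrm{Tr}(K[\mathbf Y]J_m)-\tfrac\epsilon2\mathrm{Tr}[-I+(I+cP)^{1/2}]+\tfrac\epsilon2\log\det\big(\tfrac12I+\tfrac12(I+cP)^{1/2}\big),$$ $$\begin{aligned}S^\epsilon_{d^2}(\mu_0,\mu_1)=&\tfrac1{m^2}\mathbf 1_m^T(K[\mathbf X]+K[\mathbf Y]-2K[\mathbf X,\mathbf Y])\mathbf 1_m+\tfrac\epsilon4\mathrm{Tr}[-I+(I+c(J_mK[\mathbf X]J_m)^2)^{1/2}]+\tfrac\epsilon4\mathrm{Tr}[-I+(I+c(J_mK[\mathbf Y]J_m)^2)^{1/2}]\\&-\tfrac\epsilon2\mathrm{Tr}[-I+(I+cP)^{1/2}]+\tfrac\epsilon2\log\det\big(\tfrac12I+\tfrac12(I+cP)^{1/2}\big)\\&-\tfrac\epsilon4\log\det\big(\tfrac12I+\tfrac12(I+c(J_mK[\mathbf X]J_m)^2)^{1/2}\big)-\tfrac\epsilon4\log\det\big(\tfrac12I+\tfrac12(I+c(J_mK[\mathbf Y]J_m)^2)^{1/2}\big),\end{aligned}$$ all matrices being $m\times m$. Moreover $\lim_{\epsilon\to\infty}S^\epsilon_{d^2}(\mu_0,\mu_1)=\|\mu_{\Phi(\mathbf X)}-\mu_{\Phi(\mathbf Y)}\|^2_{\mathcal H_K}=\frac1{m^2}\mathbf 1_m^T(K[\mathbf X]+K[\mathbf Y]-2K[\mathbf X,\mathbf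 Y])\mathbf 1_m$ and $\lim_{\epsilon\to0}S^\epsilon_{d^2}(\mu_0,\mu_1)=\frac1{m^2}\mathbf 1_m^T(K[\mathbf X]+K[\mathbf Y]-2K[\mathbf X,\mathbf Y])\mathbf 1_m+\frac1m\mathrm{Tr}(K[\mathbf X]J_m)+\frac1m\mathrm{Tr}(K[\mathbf Y]J_m)-\frac2m\mathrm{Tr}[P^{1/2}]$.
   Context: $\mathcal N(m,C)$ is the Gaussian measure on the Hilbert space $\mathcal H_K$ with mean $m$ and covariance $C$ (positive, trace class). $\mathrm{OT}^\epsilon_{d^2}(\mu,\nu)=\min_{\gamma\in\mathrm{Joint}(\mu,\nu)}\{\int\|x-y\|^2d\gamma+\epsilon\mathrm{KL}(\gamma\|\mu\otimes\nu)\}$ where $\mathrm{Joint}$ is the set of couplings and $\mathrm{KL}$ the Kullback–Leibler divergence; $S^\epsilon_{d^2}(\mu,\nu)=\mathrm{OT}^\epsilon_{d^2}(\mu,\nu)-\frac12(\mathrm{OT}^\epsilon_{d^2}(\mu,\mu)+\mathrm{OT}^\epsilon_{d^2}(\nu,\nu))$. $P^{1/2}$ is the square root of the positive semidefinite matrix $P$. *)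

(* Defs.v *)
From HB Require Import structures.
From mathcomp Require Import all_boot all_order all_algebra.
From mathcomp Require Import all_classical all_reals all_analysis.

Set Implicit Arguments.
Unset Strict Implicit.
Unset Printing Implicit Defensive.

Import Order.TTheory GRing.Theory Num.Theory.
Import numFieldNormedType.Exports.
Local Open Scope classical_set_scope.
Local Open Scope ring_scope.

Definition separable_space (T : topologicalType) : Prop :=
  exists D : set T, countable D /\ closure D = setT.

Definition pd_kernel {R : realType} {X : Type} (K : X -> X -> R) : Prop :=
  (forall x y, K x y = K y x) /\
  (forall (n : nat) (x : 'I_n -> X) (c : 'I_n -> R),
      0 <= \sum_(i < n) \sum_(j < n) c i * c j * K (x i) (x j)).

Definition inner_product {R : realType} {H : normedModType R}
  (ip : H -> H -> R) : Prop :=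
  [/\ forall x y, ip x y = ip y x,
      forall (a : R) (x y z : H), ip (a *: x + y) z = a * ip x z + ip y z
    & forall x, ip x x = `|x| ^+ 2].

Definition lspan {R : realType} {H : normedModType R} {X : Type}
  (Phi : X -> H) : set H :=
  [set v | exists (n : nat) (c : 'I_n -> R) (x : 'I_n -> X),
      v = \sum_(i < n) c i *: Phi (x i)].

(* (H, ip) is (isometrically) the RKHS H_K of K, with feature map Phi:
   H is a Hilbert space (complete, norm induced by ip), the reproducing
   property <Phi x, Phi y> = K x y holds, and span Phi(X) is dense. *)
Definition rkhs_feature_map {R : realType} {X : Type}
  (K : X -> X -> R) (H : completeNormedModType R) (ip : H -> H -> R)
  (Phi : X -> H) : Prop :=
  [/\ inner_product ip,
      forall x y, ip (Phi x) (Phi y) = K x y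
    & closure (lspan Phi) = setT].

Definition borel (T : topologicalType) := g_sigma_algebraType (@open T).

(* Gaussian measures on a Hilbert space (Fourier transform definition) *)
(*   mu = N(mean, C)  iff  for all h,                                  *)
(*   \int exp(i<x,h>) dmu(x) = exp(i<mean,h> - <Ch,h>/2)                *)
(*   (real and imaginary parts written separately)                      *)

Definition is_gaussian {R : realType} {H : completeNormedModType R}
  (ip : H -> H -> R) (mu : probability (borel H) R) (mean : H) (C : H -> H)
  : Prop :=
  forall h : H,
    (\int[mu]_(x in setT) (cos (ip x h))%:E =
       (expR (- (ip (C h) h) / 2) * cos (ip mean h))%:E)%E /\
    (\int[mu]_(x in setT) (sin (ip x h))%:E =
       (expR (- (ip (C h) h) / 2) * sin (ip mean h))%:E)%E.

Section EOT.
Context {R : realType} {H : completeNormedModType R}.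
Local Notation HB := (borel H).

Definition couplings (mu nu : probability HB R) :
  set (probability (HB * HB)%type R) :=
  [set g | forall A : set HB, measurable A ->
      g (A `*` setT) = mu A /\ g (setT `*` A) = nu A].

(* Kullback-Leibler divergence KL(g || p): \int f log f dp where f is a
   density dg/dp; +oo when g is not absolutely continuous w.r.t. p
   (infimum over the empty set) *)
Definition KL (g p : set (HB * HB)%type -> \bar R) : \bar R :=
  ereal_inf [set (\int[p]_(z in setT) (f z * ln (f z))%:E)%E |
     f in [set f : (HB * HB)%type -> R |
        [/\ measurable_fun setT f, forall z, 0 <= f z &
            forall A, measurable A -> g A = (\int[p]_(z in A) (f z)%:E)%E]]].

Definition sqdist_cost (g : probability (HB * HB)%type R) : \bar R :=
  (\int[g]_(z in setT) ((`|(z.1 : H) - (z.2 : H)| ^+ 2)%:E))%E.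

Definition OTeps (eps : R) (mu nu : probability HB R) : \bar R :=
  ereal_inf [set (sqdist_cost g + eps%:E * KL g (mu \x nu)%E)%E |
     g in couplings mu nu].

Definition Seps (eps : R) (mu nu : probability HB R) : \bar R :=
  (OTeps eps mu nu - 2^-1%:E * (OTeps eps mu mu + OTeps eps nu nu))%E.

End EOT.

Section Mx.
Context {R : realType}.

Definition psdmx {m : nat} (A : 'M[R]_m) : Prop :=
  forall v : 'cV[R]_m, 0 <= (v^T *m A *m v) ord0 ord0.

(* P^{1/2}: the unique symmetric positive semidefinite square root
   (chosen by description; for symmetric PSD P it exists and is unique) *)
Definition sqrtmx {m : nat} (P : 'M[R]_m) : 'M[R]_m :=
  xget 0 [set S : 'M[R]_m | [/\ S^T = S, psdmx S & S *m S = P]].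

Definition centering (m : nat) : 'M[R]_m :=
  1%:M - m%:R^-1 *: (const_mx 1 : 'cV[R]_m) *m (const_mx 1 : 'rV[R]_m).

Definition ones_form {m : nat} (A : 'M[R]_m) : R :=
  ((const_mx 1 : 'rV[R]_m) *m A *m (const_mx 1 : 'cV[R]_m)) ord0 ord0.

Definition gram {X : Type} {m : nat} (K : X -> X -> R) (x y : 'I_m -> X)
  : 'M[R]_m := \matrix_(i, j) K (x i) (y j).

End Mx.

Definition emp_mean {R : realType} {H : normedModType R} {X : Type} {m : nat}
  (Phi : X -> H) (x : 'I_m -> X) : H :=
  m%:R^-1 *: \sum_(j < m) Phi (x j).

(* empirical covariance  (1/m) Phi(X) J_m Phi(X)^*, where
   Phi(X) b = sum_j b_j Phi(x_j) and Phi(X)^* h = (<Phi(x_k), h>)_k *)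
Definition emp_cov {R : realType} {H : normedModType R} {X : Type} {m : nat}
  (ip : H -> H -> R) (Phi : X -> H) (x : 'I_m -> X) : H -> H :=
  fun h => m%:R^-1 *:
    \sum_(j < m) (\sum_(k < m) centering m j k * ip (Phi (x k)) h) *: Phi (x j).

(* Main.v *)
(* Write [w = x - m0], [z = y - m1], let [A = Phi(X) J / sqrt m] and
   [B = Phi(Y) J / sqrt m] be square roots of the two covariances, and let
   [sigma_i] be the singular values of [A^* B = J K[X,Y] J / m].  Almost surely [w]
   and [z] lie in the spans of [A] and [B], and
   [<w, z> = sum_i sigma_i xi_i eta_i] with [xi] and [eta] standard Gaussian vectors
   that are linear functions of [w] and [z].  With [k_i = 2 sigma_i / eps] and
   [a_i >= 0] the root of [a (1 + a) = k_i ^ 2], the density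
   [p = prod_i sqrt (1 + a_i) exp (- a_i (xi_i ^ 2 + eta_i ^ 2) / 2 + k_i xi_i eta_i)]
   has both marginals equal to [1], and [eps ln p + |x - y| ^ 2] splits as
   [phi x + psi y].  By Gibbs' inequality [f ln f >= f ln p + f - p] the plan with
   density [p] is optimal, with value [\int phi dmu0 + \int psi dmu1]; only second
   moments are then needed.  Gaussian measures being given by their Fourier
   transform, expectations of [exp (- a eta ^ 2 / 2)] are computed by writing this
   function as a mean of [cos (sqrt a eta W)] over a standard normal [W].
   The matrix formulas follow by diagonalizing, and the limits in [eps] are taken
   eigenvalue by eigenvalue. *)
Require Import Defs.
From HB Require Import structures.
From mathcomp Require Import all_boot all_order all_algebra.
From mathcomp Require Import all_classical all_reals all_analysis.
From mathcomp Require Import measurable_realfun ring lra.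
From mathcomp Require complex spectral.

Import Order.TTheory GRing.Theory Num.Theory.
Import numFieldNormedType.Exports.
Local Open Scope classical_set_scope.
Local Open Scope ring_scope.

Set Implicit Arguments.
Unset Strict Implicit.
Unset Printing Implicit Defensive.

(** * Densities and bounded functions *)

Section density.
Local Open Scope ereal_scope.
Context d (T : measurableType d) (R : realType).
Variables (nu : {finite_measure set T -> \bar R})
          (mu : {sigma_finite_measure set T -> \bar R}) (f : T -> R).
Hypotheses (mf : measurable_fun setT f) (f_ge0 : forall x, (0 <= f x)%R)
  (nuE : forall A, measurable A -> nu A = \int[mu]_(x in A) (f x)%:E).

Lemma density_dominates : nu `<< mu.
Proof.
apply/null_content_dominatesP => A mA muA0; rewrite nuE//.
by apply: null_set_integral => //; apply/measurable_EFinP; exact: measurable_funTS.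
Qed.

Lemma integrable_density : mu.-integrable setT (EFin \o f).
Proof.
apply/integrableP; split; first exact/measurable_EFinP.
under eq_integral do rewrite /= ger0_norm//.
by rewrite -nuE// ltey_eq fin_num_measure.
Qed.

Lemma density_ae_eq :
  ae_eq mu setT (EFin \o f) (Radon_Nikodym_SigmaFinite.f nu mu).
Proof.
apply: integral_ae_eq => //.
- exact: integrable_density.
- exact: measurable_int (Radon_Nikodym_SigmaFinite.f_integrable density_dominates).
- move=> A _ mA.
  by rewrite -(Radon_Nikodym_SigmaFinite.f_integral density_dominates)// -nuE.
Qed.

Lemma ge0_integral_density (h : T -> \bar R) : (forall x, 0 <= h x) ->
  measurable_fun setT h -> \int[nu]_x h x = \int[mu]_x (h x * (f x)%:E).
Proof.
move=> h0 mh.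
rewrite -(Radon_Nikodym_SigmaFinite.change_of_variables density_dominates)//.
have mrn : measurable_fun setT (Radon_Nikodym_SigmaFinite.f nu mu).
  exact: measurable_int (Radon_Nikodym_SigmaFinite.f_integrable density_dominates).
apply: ae_eq_integral => //.
- by apply: emeasurable_funM.
- by apply: emeasurable_funM => //; exact/measurable_EFinP.
- have := density_ae_eq; apply: filterS => x /(_ I) /= ffx _ /=.
  by rewrite ffx.
Qed.

Lemma integrable_density_mul (h : T -> R) : nu.-integrable setT (EFin \o h) ->
  mu.-integrable setT (fun x => (h x * f x)%:E).
Proof.
move=> /integrableP[mh ih]; apply/integrableP; split.
  by apply/measurable_EFinP/measurable_funM => //; exact/measurable_EFinP.
under eq_integral do rewrite /= normrM EFinM (ger0_norm (f_ge0 _)).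
rewrite -(@ge0_integral_density (fun x => `|h x|%:E))//.
by apply/measurable_EFinP/measurableT_comp => //; exact/measurable_EFinP.
Qed.

Lemma integral_density (h : T -> R) : nu.-integrable setT (EFin \o h) ->
  \int[nu]_x (h x)%:E = \int[mu]_x (h x * f x)%:E.
Proof.
move=> ih; have mh := measurable_int _ ih.
rewrite integralE [RHS]integralE.
rewrite !ge0_integral_density//; try exact: measurable_funepos; try exact: measurable_funeneg.
congr (_ - _); apply: eq_integral => x _.
  by rewrite !funeposE -!EFin_max -EFinM maxr_pMl// mul0r.
by rewrite !funenegE -!EFinN -!EFin_max -EFinM maxr_pMl// mul0r mulNr.
Qed.

End density.

Section Rintegral_theory.
Context d (T : measurableType d) (R : realType) (mu : {measure set T -> \bar R}).

Lemma EFin_Rintegral (f : T -> R) : mu.-integrable setT (EFin \o f) ->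
  (\int[mu]_x (f x)%:E)%E = (\int[mu]_x f x)%:E.
Proof. by move=> fi; rewrite /Rintegral fineK// integrable_fin_num. Qed.

End Rintegral_theory.

Section bounded_integrable.
Context d (T : measurableType d) (R : realType) (P : {finite_measure set T -> \bar R}).

Lemma bounded_integrable (f : T -> R) (c : R) : measurable_fun setT f ->
  (forall x, `|f x| <= c) -> P.-integrable setT (EFin \o f).
Proof.
move=> mf fc; apply: (@le_integrable _ _ _ P _ _ _ (EFin \o cst c)) => //.
- exact/measurable_EFinP.
- by move=> x _ /=; rewrite lee_fin (le_trans (fc x))// ler_norm.
- exact: finite_measure_integrable_cst.
Qed.

End bounded_integrable.

Section bounded_Fubini.
Context d1 d2 (T1 : measurableType d1) (T2 : measurableType d2) (R : realType).
Variables (P : probability T1 R) (Q : probability T2 R).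

Lemma Rintegral_Fubini_bounded (f : T1 * T2 -> R) (c : R) :
  measurable_fun setT f -> (forall z, `|f z| <= c) ->
  \int[P]_x \int[Q]_y f (x, y) = \int[Q]_y \int[P]_x f (x, y).
Proof.
move=> mf fc.
have intf : (P \x Q)%E.-integrable setT (EFin \o f).
  exact: (@bounded_integrable _ _ _ (P \x Q : probability (T1 * T2)%type R)%E f c mf fc).
have E1 x : (\int[Q]_y (f (x, y))%:E)%E = (\int[Q]_y f (x, y))%:E.
  rewrite EFin_Rintegral//; apply: (bounded_integrable _ (c := c)) => //.
  exact: measurableT_comp.
have E2 y : (\int[P]_x (f (x, y))%:E)%E = (\int[P]_x f (x, y))%:E.
  rewrite EFin_Rintegral//; apply: (bounded_integrable _ (c := c)) => //.
  exact: measurableT_comp.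
have := Fubini intf => /=.
under eq_integral do rewrite E1.
under [RHS]eq_integral do rewrite E2.
by rewrite /Rintegral => ->.
Qed.

End bounded_Fubini.

(** * Spectral theory of real symmetric matrices *)

Section real_spectral.
Import complex.
Context {R : realType}.

Lemma mx11_dot_eq0 n (v : 'rV[R]_n) : v *m v^T = 0 -> v = 0.
Proof.
move=> /matrixP/(_ ord0 ord0); rewrite !mxE => /eqP.
rewrite psumr_eq0 => [/allP v0|i _]; last by rewrite mxE -expr2 sqr_ge0.
apply/rowP => i; have := v0 i; rewrite mem_index_enum mxE => /(_ isT).
by rewrite mulf_eq0 orbb mxE => /eqP.
Qed.

Lemma mx11_dot_ge0 n (v : 'rV[R]_n) : 0 <= (v *m v^T) 0 0.
Proof. by rewrite mxE sumr_ge0// => i _; rewrite mxE -expr2 sqr_ge0. Qed.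

(* The real and imaginary parts [x], [y] of a complex eigenvector for [l + i k]
   satisfy [k (|x| ^ 2 + |y| ^ 2) = 0] by symmetry. *)
Lemma symmetric_eigenvalue n (A : 'M[R]_n.+1) : A^T = A ->
  exists (l : R) (v : 'rV[R]_n.+1), v *m A = l *: v /\ v *m v^T = 1%:M.
Proof.
move=> AT.
have [z /eigenvalueP[v vA v0]] := @spectral.eigenvalue_closed (complex.complex R) _
  (map_mx (fun a : R => complex.Complex a 0) A) (ltn0Sn n).
pose l := complex.Re z; pose k := complex.Im z.
pose x : 'rV[R]_n.+1 := \row_i complex.Re (v 0 i).
pose y : 'rV[R]_n.+1 := \row_i complex.Im (v 0 i).
have xA : x *m A = l *: x - k *: y.
  apply/rowP => i; rewrite !mxE; have /rowP/(_ i) := vA; rewrite !mxE => /(congr1 (@complex.Re R)).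
  rewrite (big_morph (@complex.Re R) (id1 := 0) (op1 := +%R)) //; last by move=> [a b] [c d].
  rewrite /l /k; case: z {l k vA} => l k; case: (v 0 i) => a b /= <-.
  apply: eq_bigr => j _; rewrite !mxE; case: (v 0 j) => c d /=.
  by rewrite mulr0 subr0.
have yA : y *m A = l *: y + k *: x.
  apply/rowP => i; rewrite !mxE; have /rowP/(_ i) := vA; rewrite !mxE => /(congr1 (@complex.Im R)).
  rewrite (big_morph (@complex.Im R) (id1 := 0) (op1 := +%R)) //; last by move=> [a b] [c d].
  rewrite /l /k; case: z {l k vA xA} => l k; case: (v 0 i) => a b /= <-.
  apply: eq_bigr => j _; rewrite !mxE; case: (v 0 j) => c d /=.
  by rewrite mulr0 add0r.
have tr1 (M : 'M[R]_1) : M^T = M by apply/matrixP => i j; rewrite mxE !ord1.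
have sym (a b : 'rV[R]_n.+1) : a *m b^T = b *m a^T.
  by rewrite -[LHS]tr1 trmx_mul trmxK.
have k0 : k * ((x *m x^T) 0 0 + (y *m y^T) 0 0) = 0.
  have : x *m A *m y^T = y *m A *m x^T.
    by rewrite -[LHS]tr1 !trmx_mul trmxK AT mulmxA.
  rewrite xA yA mulmxBl mulmxDl -!scalemxAl (sym y x) => /matrixP/(_ 0 0).
  by rewrite !mxE => h; lra.
have xy0 : (x != 0) || (y != 0).
  rewrite -negb_and; apply: contra v0 => /andP[/eqP x0 /eqP y0]; apply/eqP/rowP => i.
  have /rowP/(_ i) := x0; have /rowP/(_ i) := y0; rewrite !mxE.
  by case: (v 0 i) => a b /= -> ->.
have kz : k = 0.
  move/eqP: k0; rewrite mulf_eq0 => /orP[/eqP//|].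
  rewrite paddr_eq0 ?mx11_dot_ge0// => /andP[/eqP x0 /eqP y0].
  case/orP: xy0 => /eqP []; apply: mx11_dot_eq0; rewrite [LHS]mx11_scalar ?x0 ?y0;
  by rewrite raddf0.
rewrite kz !scale0r subr0 addr0 in xA yA.
have [w [w0 wA]] : exists w : 'rV[R]_n.+1, w != 0 /\ w *m A = l *: w.
  by case/orP: xy0 => h; [exists x|exists y].
have N0 : 0 < (w *m w^T) 0 0.
  rewrite lt_neqAle mx11_dot_ge0 andbT eq_sym; apply: contra w0 => /eqP N0.
  by apply/eqP/mx11_dot_eq0; rewrite [LHS]mx11_scalar N0 raddf0.
have : w *m w^T = ((w *m w^T) 0 0)%:M by exact: mx11_scalar.
move: ((w *m w^T) 0 0) N0 => N N0 wN.
exists l, ((Num.sqrt N)^-1 *: w); split.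
  by rewrite -scalemxAl wA scalerA mulrC -scalerA.
rewrite linearZ/= -scalemxAl -scalemxAr scalerA wN scale_scalar_mx.
by rewrite -invfM -expr2 sqr_sqrtr ?ltW// mulVf// gt_eqF.
Qed.

Lemma orthogonal_first_row n (v : 'rV[R]_n.+1) : v *m v^T = 1%:M ->
  exists2 Q : 'M[R]_n.+1, Q *m Q^T = 1%:M & row ord0 Q = v.
Proof.
move=> vv; pose e : 'rV[R]_n.+1 := delta_mx 0 0.
have ee : e *m e^T = 1%:M.
  by rewrite trmx_delta mul_delta_mx; apply/matrixP => i j; rewrite !ord1 !mxE !eqxx.
have [->|ve] := eqVneq v e; first by exists 1%:M; rewrite ?trmx1 ?mulmx1 ?row1.
pose u := v - e; pose N := (u *m u^T) 0 0.
have uN : u *m u^T = N%:M by rewrite [LHS]mx11_scalar.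
have N0 : N != 0.
  apply: contra_neq ve => N0; apply/eqP; rewrite -subr_eq0; apply/eqP.
  by apply: mx11_dot_eq0; rewrite -/u uN N0 raddf0.
have eu : e *m u^T = (- (N / 2))%:M.
  have : (u *m u^T) + 2 *: (e *m u^T) = 0.
    have ev : v *m e^T = e *m v^T.
      by rewrite [LHS]mx11_scalar [RHS]mx11_scalar -[v *m e^T]trmxK trmx_mul trmxK mxE.
    rewrite /u raddfB/= mulmxBl !mulmxBr vv ee ev scalerBr scaler_nat mulr2n scaler_nat mulr2n.
    by apply/matrixP => i j; rewrite !mxE; ring.
  rewrite uN => /eqP; rewrite addr_eq0 => /eqP h.
  apply: (@scalerI _ _ 2); first by rewrite pnatr_eq0.
  by rewrite -[LHS]opprK -h; apply/matrixP => i j; rewrite !ord1 !mxE eqxx !mulr1n; field.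
pose Q := 1%:M - (2 / N) *: (u^T *m u).
have QT : Q^T = Q by rewrite /Q raddfB/= linearZ/= trmx_mul trmxK trmx1.
exists Q; last first.
  rewrite rowE -/e /Q mulmxBr mulmx1 -scalemxAr mulmxA eu mul_scalar_mx scalerA.
  have -> : 2 / N * - (N / 2) = -1 by field.
  by rewrite scaleN1r opprK /u addrC subrK.
have PP : (u^T *m u) *m (u^T *m u) = N *: (u^T *m u).
  by rewrite mulmxA -(mulmxA u^T) uN mul_mx_scalar -scalemxAl.
rewrite QT /Q; move: (u^T *m u) PP => P PP; rewrite mulmxBl mul1mx mulmxBr mulmx1 -scalemxAl -scalemxAr PP.
by apply/matrixP => i j; rewrite !mxE; field.
Qed.

Lemma spectral_symmetric n (A : 'M[R]_n) : A^T = A ->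
  exists (U : 'M[R]_n) (d : 'rV[R]_n),
    U *m U^T = 1%:M /\ A = U *m diag_mx d *m U^T.
Proof.
elim: n A => [A _|n IH A AT].
  by exists 1%:M, 0; split; apply/matrixP => -[].
have [l [v [vA vv]]] := symmetric_eigenvalue AT.
have [Q QQ Qv] := orthogonal_first_row vv.
have QQ' : Q^T *m Q = 1%:M by exact: mulmx1C.
have [B BQ] : exists B : 'M[R]_(1 + n), B = Q *m A *m Q^T by exists (Q *m A *m Q^T).
have BT : B^T = B by rewrite BQ !trmx_mul trmxK AT mulmxA.
have B0 : row 0 B = l *: (delta_mx 0 0).
  rewrite BQ !row_mul Qv vA -scalemxAl -Qv -row_mul QQ.
  by rewrite rowE mulmx1.
have B0j j : B 0 j = l * (j == 0)%:R.
  by have /rowP/(_ j) := B0; rewrite !mxE eqxx.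
have ulE : ulsubmx B = l%:M.
  by apply/matrixP => i j; rewrite !ord1 !mxE lshift0 B0j eqxx !mulr1.
have urE : ursubmx B = 0.
  by apply/matrixP => i j; rewrite !ord1 !mxE lshift0 B0j mulr0.
have dlE : dlsubmx B = 0 by rewrite -BT -trmx_ursub urE trmx0.
have drT : (drsubmx B)^T = drsubmx B by rewrite trmx_drsub BT.
have [U' [d' [UU' BE]]] := IH _ drT.
pose W : 'M[R]_(1 + n) := block_mx 1%:M 0 0 U'.
have WT : W^T = block_mx 1%:M 0 0 U'^T by rewrite /W tr_block_mx trmx1 !trmx0.
have WW : W *m W^T = 1%:M.
  rewrite WT mulmx_block !mul1mx !mulmx0 !mul0mx !addr0 add0r UU'.
  by rewrite -scalar_mx_block.
exists (Q^T *m W), (row_mx l%:M d' : 'rV[R]_(1 + n)); split.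
  by rewrite trmx_mul trmxK mulmxA -(mulmxA _ W) WW mulmx1.
have BWE : B = W *m diag_mx (row_mx l%:M d') *m W^T.
  rewrite -[LHS]submxK ulE urE dlE BE diag_mx_row WT !mulmx_block.
  rewrite !mul1mx !mulmx0 !mul0mx !addr0 !add0r ?mulmx0 ?mul0mx mulmx1.
  by congr block_mx; apply/matrixP => i j; rewrite !ord1 !mxE.
have AE : A = Q^T *m B *m Q.
  by rewrite BQ !mulmxA QQ' mul1mx -mulmxA QQ' mulmx1.
by rewrite AE BWE trmx_mul trmxK !mulmxA.
Qed.

End real_spectral.

Section spectral_sqrt.
Context {R : realType} (n : nat) (U : 'M[R]_n).
Hypothesis UU : U *m U^T = 1%:M.

Let UU' : U^T *m U = 1%:M.
Proof. exact: mulmx1C. Qed.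

Lemma mul_spectral (d e : 'rV[R]_n) :
  (U *m diag_mx d *m U^T) *m (U *m diag_mx e *m U^T) =
  U *m diag_mx (\row_i (d 0 i * e 0 i)) *m U^T.
Proof.
rewrite !mulmxA -(mulmxA _ U^T) UU' mulmx1 -(mulmxA U) mulmx_diag.
by congr (_ *m diag_mx _ *m _); apply/rowP => i; rewrite !mxE.
Qed.

Lemma trmx_spectral (d : 'rV[R]_n) :
  (U *m diag_mx d *m U^T)^T = U *m diag_mx d *m U^T.
Proof. by rewrite !trmx_mul trmxK tr_diag_mx mulmxA. Qed.

Lemma psdmx_spectral (d : 'rV[R]_n) :
  psdmx (U *m diag_mx d *m U^T) <-> forall i, 0 <= d 0 i.
Proof.
split=> [dpsd i|d0 v].
  have := dpsd (U *m delta_mx i 0).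
  rewrite trmx_mul trmx_delta !mulmxA -(mulmxA _ U^T U) UU' mulmx1.
  rewrite -(mulmxA _ U^T U) UU' mulmx1 -rowE -colE !mxE eqxx mulr1n.
  by [].
rewrite !mulmxA -(mulmxA _ U^T v) -[v^T *m U]trmxK trmx_mul trmxK.
set w := U^T *m v; rewrite mul_mx_diag mxE sumr_ge0// => i _.
by rewrite !mxE mulrAC -expr2 mulr_ge0// sqr_ge0.
Qed.

Lemma mxtrace_spectral (d : 'rV[R]_n) : \tr (U *m diag_mx d *m U^T) = \sum_i d 0 i.
Proof. by rewrite mxtrace_mulC mulmxA UU' mul1mx mxtrace_diag. Qed.

Lemma det_spectral (d : 'rV[R]_n) : \det (U *m diag_mx d *m U^T) = \prod_i d 0 i.
Proof.
by rewrite !det_mulmx mulrAC -det_mulmx UU det1 mul1r det_diag.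
Qed.

Lemma affine_spectral (a b : R) (d : 'rV[R]_n) :
  a *: 1%:M + b *: (U *m diag_mx d *m U^T) =
  U *m diag_mx (\row_i (a + b * d 0 i)) *m U^T.
Proof.
have -> : diag_mx (\row_i (a + b * d 0 i)) = a *: 1%:M + b *: diag_mx d.
  by apply/matrixP => i j; rewrite !mxE mulrnDl; case: eqP => _; rewrite ?mulr1 ?mulr0 ?mulr0n ?mulr1n.
by rewrite mulmxDr mulmxDl -!scalemxAr mulmx1 -!scalemxAl UU.
Qed.

End spectral_sqrt.

Lemma sqrtmx_spectral {R : realType} n (U : 'M[R]_n) (d : 'rV[R]_n) :
  U *m U^T = 1%:M -> (forall i, 0 <= d 0 i) ->
  sqrtmx (U *m diag_mx d *m U^T) = U *m diag_mx (\row_i Num.sqrt (d 0 i)) *m U^T.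
Proof.
move=> UU d0; set P := U *m _ *m _; set S0 := RHS.
have S0S0 : S0 *m S0 = P.
  rewrite /S0 mul_spectral// /P; congr (_ *m diag_mx _ *m _); apply/rowP => i.
  by rewrite !mxE -expr2 sqr_sqrtr.
apply: xget_unique => [|S [ST Spsd SS]].
  split; [exact: trmx_spectral| |exact: S0S0].
  by apply/psdmx_spectral => // i; rewrite mxE sqrtr_ge0.
have [V [s [VV SE]]] := spectral_symmetric ST.
have VV' := mulmx1C VV; have UU' := mulmx1C UU.
have s0 : forall i, 0 <= s 0 i by apply/(psdmx_spectral VV); rewrite -SE.
have [W WE] : exists W : 'M[R]_n, W = V^T *m U by exists (V^T *m U).
have sW i j : s 0 i ^+ 2 * W i j = W i j * d 0 j.
  have : diag_mx (\row_i (s 0 i * s 0 i)) *m W = W *m diag_mx d.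
    have := SS; rewrite {1 2}SE mul_spectral// /P => /(congr1 (fun M => V^T *m M *m U)).
    rewrite !mulmxA VV' mul1mx -(mulmxA _ U^T) UU' mulmx1 WE => h.
    by rewrite mulmxA h.
  by rewrite mul_diag_mx mul_mx_diag => /matrixP/(_ i j); rewrite !mxE.
have DW : diag_mx s *m W = W *m diag_mx (\row_i Num.sqrt (d 0 i)).
  rewrite mul_diag_mx mul_mx_diag; apply/matrixP => i j; rewrite !mxE.
  have := sW i j; rewrite mulrC; have [->|W0] := eqVneq (W i j) 0.
    by move=> _; rewrite mul0r mulr0.
  by move=> /(mulfI W0) <-; rewrite sqrtr_sqr ger0_norm// mulrC.
have : V *m (diag_mx s *m W) *m U^T = V *m (W *m diag_mx (\row_i Num.sqrt (d 0 i))) *m U^T.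
  by rewrite DW.
by rewrite WE !mulmxA -(mulmxA _ U U^T) UU mulmx1 -SE VV mul1mx.
Qed.

Lemma symmetric_psd_spectral {R : realType} n (A : 'M[R]_n) : A^T = A -> psdmx A ->
  exists (U : 'M[R]_n) (d : 'rV[R]_n),
    [/\ U *m U^T = 1%:M, A = U *m diag_mx d *m U^T & forall i, 0 <= d 0 i].
Proof.
move=> AT Apsd; have [U [d [UU AE]]] := spectral_symmetric AT.
by exists U, d; split=> //; apply/(psdmx_spectral UU); rewrite -AE.
Qed.

Section spectral_formulas.
Context {R : realType} (n : nat) (U : 'M[R]_n) (d : 'rV[R]_n) (c : R).
Hypotheses (UU : U *m U^T = 1%:M) (d0 : forall i, 0 <= d 0 i) (c0 : 0 <= c).

Let sqrtE : sqrtmx (1%:M + c *: (U *m diag_mx d *m U^T)) =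
  U *m diag_mx (\row_i Num.sqrt (1 + c * d 0 i)) *m U^T.
Proof.
rewrite -[X in X + _]scale1r affine_spectral// sqrtmx_spectral//.
  by congr (_ *m diag_mx _ *m _); apply/rowP => i; rewrite !mxE.
by move=> i; rewrite mxE addr_ge0// mulr_ge0.
Qed.

Lemma mxtrace_sqrtmx_affine :
  \tr (- 1%:M + sqrtmx (1%:M + c *: (U *m diag_mx d *m U^T))) =
  \sum_i (Num.sqrt (1 + c * d 0 i) - 1).
Proof.
rewrite sqrtE -scaleN1r -[X in _ + X]scale1r affine_spectral// mxtrace_spectral//.
by apply: eq_bigr => i _; rewrite !mxE mul1r addrC.
Qed.

Lemma ln_det_sqrtmx_affine :
  ln (\det (2^-1 *: 1%:M + 2^-1 *: sqrtmx (1%:M + c *: (U *m diag_mx d *m U^T)))) =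
  \sum_i ln (2^-1 + 2^-1 * Num.sqrt (1 + c * d 0 i)).
Proof.
rewrite sqrtE affine_spectral// det_spectral//.
have p i : 0 < 2^-1 + 2^-1 * Num.sqrt (1 + c * d 0 i).
  by rewrite ltr_pwDl ?invr_gt0// mulr_ge0// ?invr_ge0// sqrtr_ge0.
transitivity (ln (\prod_i (2^-1 + 2^-1 * Num.sqrt (1 + c * d 0 i)))).
  by congr ln; apply: eq_bigr => i _; rewrite !mxE.
suff [] : 0 < \prod_i (2^-1 + 2^-1 * Num.sqrt (1 + c * d 0 i)) /\
  ln (\prod_i (2^-1 + 2^-1 * Num.sqrt (1 + c * d 0 i))) =
  \sum_i ln (2^-1 + 2^-1 * Num.sqrt (1 + c * d 0 i)) by [].
apply: (big_ind2 (fun u v : R => 0 < u /\ ln u = v)).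
- by rewrite ln1.
- by move=> u v u' v' [u0 <-] [u'0 <-]; rewrite mulr_gt0// lnM ?posrE.
- by move=> i _.
Qed.

End spectral_formulas.

(** * One-dimensional Gaussian integrals *)

Section gaussian_cosine.
Context {R : realType}.
Local Notation leb := (@lebesgue_measure R).

Definition gauss_bell (q x : R) : R := expR (- (q * x ^+ 2 / 2)).

Lemma gauss_bell_gt0 (q x : R) : 0 < gauss_bell q x.
Proof. exact: expR_gt0. Qed.

Lemma gauss_bell_ge0 (q x : R) : 0 <= gauss_bell q x.
Proof. exact: expR_ge0. Qed.

Lemma is_derive_gauss_bell (q x : R) :
  is_derive x 1 (gauss_bell q) (- (q * x) * gauss_bell q x).
Proof.
rewrite mulrC; apply: (@is_derive1_comp _ expR (fun x => - (q * x ^+ 2 / 2))).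
by apply: is_derive_eq; rewrite /GRing.scale/=; field.
Qed.

Lemma continuous_gauss_bell (q : R) : continuous (gauss_bell q).
Proof.
move=> x; apply: differentiable_continuous; apply/derivable1_diffP.
by apply: ex_derive; exact: is_derive_gauss_bell.
Qed.

Lemma measurable_gauss_bell (q : R) : measurable_fun setT (gauss_bell q).
Proof. exact: continuous_measurable_fun (@continuous_gauss_bell q). Qed.

Lemma gauss_bellE (q x : R) : 0 < q ->
  gauss_bell q x = (normal_peak (Num.sqrt q^-1))^-1 * normal_pdf 0 (Num.sqrt q^-1) x.
Proof.
move=> q0; have s0 : Num.sqrt q^-1 != 0 by rewrite gt_eqF// sqrtr_gt0 invr_gt0.
rewrite normal_pdfE// mulKf ?gt_eqF ?normal_peak_gt0// /normal_fun.
rewrite sqr_sqrtr ?invr_ge0 ?ltW// /gauss_bell subr0; congr expR.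
by rewrite -mulr_natr; field; rewrite gt_eqF.
Qed.

Lemma integrable_gauss_bell (q : R) : 0 < q -> leb.-integrable setT (EFin \o gauss_bell q).
Proof.
move=> q0; rewrite [X in integrable _ _ X](_ : _ = fun x =>
  ((normal_peak (Num.sqrt q^-1))^-1%:E * (normal_pdf 0 (Num.sqrt q^-1) x)%:E)%E).
  by apply: integrableZl => //; exact: integrable_normal_pdf.
by apply/funext => x /=; rewrite gauss_bellE.
Qed.

Lemma Rintegral_gauss_bell (q : R) : 0 < q ->
  \int[leb]_x gauss_bell q x = Num.sqrt (q^-1 * pi *+ 2).
Proof.
move=> q0; under eq_Rintegral do rewrite gauss_bellE//.
rewrite RintegralZl//; last exact: integrable_normal_pdf.
rewrite [X in _ * X]/Rintegral integral_normal_pdf/= mulr1 /normal_peak invrK.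
by rewrite sqr_sqrtr// invr_ge0 ltW.
Qed.

Lemma norm_sin_le1 (x : R) : `|sin x| <= 1.
Proof. by rewrite ler_norml sin_geN1 sin_le1. Qed.

Lemma norm_cos_le1 (x : R) : `|cos x| <= 1.
Proof. by rewrite ler_norml cos_geN1 cos_le1. Qed.

Lemma normr_le_sqr (q x : R) : 0 < q ->
  `|x| <= (1 + 4 / q) * (1 + q / 2 * x ^+ 2 / 2).
Proof.
move=> q0; have -> : (1 + 4 / q) * (1 + q / 2 * x ^+ 2 / 2) =
    1 + 4 / q + q / 4 * x ^+ 2 + x ^+ 2 by field; rewrite gt_eqF.
have : 0 <= 4 / q by rewrite divr_ge0// ltW.
have : 0 <= q / 4 * x ^+ 2 by rewrite mulr_ge0 ?sqr_ge0// divr_ge0// ltW.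
have : 0 <= (`|x| - 1) ^+ 2 by exact: sqr_ge0.
rewrite sqrrB1 real_normK ?num_real// -mulr_natr.
have : 0 <= `|x| by exact: normr_ge0.
lra.
Qed.

Lemma integrable_moment1_gauss_bell (q : R) : 0 < q ->
  leb.-integrable setT (fun x : R => (`|x| * gauss_bell q x)%:E).
Proof.
move=> q0; pose c := 1 + 4 / q.
have c0 : 0 < c by rewrite addr_gt0// divr_gt0.
have q20 : 0 < q / 2 by rewrite divr_gt0.
apply: (@le_integrable _ _ _ leb _ _ _ (fun x => c%:E * (gauss_bell (q / 2) x)%:E)%E) => //.
- apply/measurable_EFinP; apply: measurable_funM; first exact: (continuous_measurable_fun (@norm_continuous _ R^o)).
  exact: measurable_gauss_bell.
- move=> x _ /=; rewrite lee_fin !normrM normr_id (gtr0_norm c0).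
  rewrite (gtr0_norm (gauss_bell_gt0 q x)) (gtr0_norm (gauss_bell_gt0 (q / 2) x)).
  have -> : gauss_bell q x = gauss_bell (q / 2) x * gauss_bell (q / 2) x.
    by rewrite /gauss_bell -expRD; congr expR; field.
  rewrite mulrA ler_wpM2r ?gauss_bell_ge0//.
  rewrite -ler_pdivlMr ?gauss_bell_gt0// /gauss_bell -expRN opprK.
  apply: (@le_trans _ _ (c * (1 + q / 2 * x ^+ 2 / 2))); last first.
    by rewrite ler_pM2l// expR_ge1Dx.
  exact: (normr_le_sqr x q0).
- by apply: integrableZl => //; exact: integrable_gauss_bell.
Qed.

Lemma gauss_bell_cvg0 (q : R) : 0 < q -> gauss_bell q n%:R @[n --> \oo] --> (0 : R).
Proof.
move=> q0.
apply: (@squeeze_cvgr _ _ _ _ (fun=> 0) (fun n => (2 / q) * (n.+1%:R)^-1)).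
- near=> n; rewrite gauss_bell_ge0/=.
  have n2 : (2 <= n)%N by near: n; exact: nbhs_infty_ge.
  have n1 : (0 < n%:R :> R) by rewrite ltr0n (leq_trans _ n2).
  rewrite -[leRHS]invrK -[leLHS]invrK lef_pV2 ?posrE ?invr_gt0 ?expR_gt0//; last first.
    by rewrite mulr_gt0 ?divr_gt0 ?invr_gt0.
  rewrite -expRN opprK invfM invf_div invrK.
  apply: le_trans (expR_ge1Dx _).
  have : (n.+1%:R : R) <= n%:R ^+ 2.
    rewrite -natrX ler_nat expnS expn1 (@leq_trans (n * 2))//; last by rewrite leq_mul2l n2 orbT.
    by rewrite muln2 -addnn -addn1 leq_add2l (leq_trans _ n2).
  by nra.
- exact: cvg_cst.
- rewrite -[X in _ --> X](mulr0 (2 / q)); apply: cvgM; first exact: cvg_cst.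
  exact: cvg_harmonic.
Unshelve. all: by end_near. Qed.

(* The derivative of an integrable function vanishing at both infinities has
   integral zero; here the function is [sin (b x) exp (- q x ^ 2 / 2)]. *)
Lemma gauss_bell_by_parts (q b : R) : 0 < q ->
  \int[leb]_x (b * cos (b * x) * gauss_bell q x
               - q * x * sin (b * x) * gauss_bell q x) = 0.
Proof.
move=> q0.
pose h x := b * cos (b * x) * gauss_bell q x - q * x * sin (b * x) * gauss_bell q x.
pose h0 x := sin (b * x) * gauss_bell q x.
have dh (x : R) : is_derive x 1 h0 (h x).
  have d1 : is_derive x 1 (fun x => sin (b * x)) (cos (b * x) * b).
    apply: (@is_derive1_comp _ sin (fun x => b * x)).
    by apply: is_derive_eq; rewrite /GRing.scale/= mulr1.
  have := is_deriveM d1 (is_derive_gauss_bell q x).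
  by rewrite /GRing.scale/= /h => hh; apply: (is_derive_eq hh); ring.
have cM : continuous (fun x : R => b * x) by move=> x; exact: mulrl_continuous.
have cC : continuous (fun x : R => cos (b * x)).
  by move=> x; apply: continuous_comp; [exact: cM|exact: continuous_cos].
have cS : continuous (fun x : R => sin (b * x)).
  by move=> x; apply: continuous_comp; [exact: cM|exact: continuous_sin].
have ch : continuous h.
  move=> x; apply: cvgB; apply: cvgM.
  - by apply: cvgM; [exact: cvg_cst|exact: cC].
  - exact: continuous_gauss_bell.
  - by apply: cvgM; [exact: mulrl_continuous|exact: cS].
  - exact: continuous_gauss_bell.
have ih : leb.-integrable setT (EFin \o h).
  apply: (@le_integrable _ _ _ leb _ _ _
    (fun x => `|b|%:E * (gauss_bell q x)%:E + q%:E * (`|x| * gauss_bell q x)%:E)%E) => //.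
  - by apply/measurable_EFinP; exact: continuous_measurable_fun.
  - move=> x _ /=; rewrite lee_fin (le_trans (ler_normB _ _))//.
    rewrite [leRHS]ger0_norm; last first.
      by rewrite addr_ge0// ?mulr_ge0// ?gauss_bell_ge0// ltW// gauss_bell_gt0.
    rewrite !normrM (gtr0_norm q0) (gtr0_norm (gauss_bell_gt0 q x)) mulrA.
    apply: lerD; rewrite ler_wpM2r ?gauss_bell_ge0//.
      by rewrite ler_piMr// norm_cos_le1.
    by rewrite ler_piMr ?norm_sin_le1// mulr_ge0// ltW.
  - apply: integrableD => //; apply: integrableZl => //.
      exact: integrable_gauss_bell.
    exact: integrable_moment1_gauss_bell.
pose f_ n x := ((h \_ `[- (n%:R : R), n%:R]) x)%:E.
have cvg1 : (\int[leb]_x f_ n x)%E @[n --> \oo] --> (\int[leb]_x (h x)%:E)%E.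
  apply: (@dominated_cvg _ _ _ leb _ _ _ _ (fun x => `|(h x)%:E|%E)) => //.
  - move=> n; apply/measurable_EFinP; apply: (proj1 (@measurable_restrictT _ _ _ _ `[- (n%:R : R), n%:R] h _)) => //.
    by apply: (measurable_funS measurableT) => //; exact: continuous_measurable_fun.
  - move=> x _; apply: cvg_near_cst; near=> n; rewrite /f_ patchE ifT// inE/= in_itv/=.
    rewrite -ler_norml; near: n; exact: nbhs_infty_ger.
  - exact: integrable_abse.
  - move=> n x _; rewrite /f_ patchE /= lee_fin; case: ifP => // _.
    by rewrite normr0.
have intE : \forall n \near \oo, (\int[leb]_x f_ n x)%E = (h0 n%:R - h0 (- n%:R))%:E.
  near=> n; rewrite [LHS](_ : _ = (\int[leb]_(x in `[(- n%:R)%R, (n%:R)%R]) (h x)%:E)%E).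
    have n0 : (0 < n)%N by near: n; exact: nbhs_infty_gt.
    rewrite EFinB; apply: continuous_FTC2.
    - by rewrite gtrN// ltr0n.
    - exact: continuous_subspaceT.
    - have ch0 : continuous h0.
        move=> x; apply: differentiable_continuous; apply/derivable1_diffP.
        by apply: ex_derive; exact: dh.
      split.
      + by move=> x _; apply: ex_derive; exact: dh.
      + exact/cvg_at_right_filter/ch0.
      + exact/cvg_at_left_filter/ch0.
    - by move=> x _; rewrite derive1E; apply: derive_val.
  rewrite [RHS]integral_mkcond; apply: eq_integral => x _.
  by rewrite /f_ !patchE; case: ifP.
have cvg2 : (\int[leb]_x f_ n x)%E @[n --> \oo] --> 0%E.
  have e : (h0 n%:R - h0 (- n%:R))%:E @[n --> \oo] --> (0 : R)%:E.
    apply: cvg_EFin; first exact: nearW.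
    apply: norm_cvg0.
    apply: (@squeeze_cvgr _ _ _ _ (fun=> 0) (fun n => 2 * gauss_bell q n%:R)).
    - near=> n; rewrite normr_ge0/= (le_trans (ler_normB _ _))//.
      rewrite /h0 !normrM /gauss_bell sqrrN -/(gauss_bell q n%:R).
      rewrite (gtr0_norm (gauss_bell_gt0 _ _)) -mulrDl ler_wpM2r ?gauss_bell_ge0//.
      by rewrite (_ : 2 = 1 + 1)// lerD ?norm_sin_le1.
    - exact: cvg_cst.
    - rewrite -[X in _ --> X](mulr0 2); apply: cvgM; first exact: cvg_cst.
      exact: gauss_bell_cvg0.
  apply: cvg_trans e; apply: near_eq_cvg; near=> n.
  by apply/esym; near: n.
by rewrite /Rintegral (cvg_unique _ cvg1 cvg2).
Unshelve. all: by end_near. Qed.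

Lemma Rintegral_cos_gauss_bell (q b : R) : 0 < q ->
  \int[leb]_x (cos (b * x) * gauss_bell q x) =
  expR (- (b ^+ 2 / (2 * q))) * Num.sqrt (q^-1 * pi *+ 2).
Proof.
move=> q0; pose f b x := cos (b * x) * gauss_bell q x.
pose F b := \int[leb]_x f b x.
have cM (c : R) : continuous (fun x : R => c * x) by move=> x; exact: mulrl_continuous.
have mf c : measurable_fun setT (f c).
  apply: measurable_funM; last exact: measurable_gauss_bell.
  apply: continuous_measurable_fun => x.
  by apply: continuous_comp; [exact: cM|exact: continuous_cos].
have intf c : leb.-integrable setT (EFin \o f c).
  apply: (@le_integrable _ _ _ leb _ _ _ (EFin \o gauss_bell q)) => //.
  - by apply/measurable_EFinP; exact: (mf c).
  - move=> x _ /=; rewrite lee_fin normrM ler_piMl// norm_cos_le1//.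
  - exact: integrable_gauss_bell.
have df (c x : R) : is_derive c 1 (f^~ x) (- sin (c * x) * x * gauss_bell q x).
  have d1 : is_derive c 1 (fun c => cos (c * x)) (- sin (c * x) * x).
    apply: (@is_derive1_comp _ cos (fun c => c * x)).
    by apply: is_derive_eq; rewrite /GRing.scale/=; ring.
  have d2 := is_deriveM d1 (is_derive_cst (gauss_bell q x) c 1).
  apply: (is_derive_eq d2); rewrite /GRing.scale/=; ring.
have intxs (c : R) :
    leb.-integrable setT (EFin \o (fun x => sin (c * x) * x * gauss_bell q x)).
  apply: (@le_integrable _ _ _ leb _ _ _ (fun x : R => (`|x| * gauss_bell q x)%:E)) => //.
  - apply/measurable_EFinP; apply: measurable_funM; last exact: measurable_gauss_bell.
    apply: measurable_funM => //; apply: continuous_measurable_fun => x.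
    by apply: continuous_comp; [exact: cM|exact: continuous_sin].
  - move=> x _ /=; rewrite lee_fin !normrM normr_id -mulrA ler_piMl// norm_sin_le1//.
  - exact: integrable_moment1_gauss_bell.
have duf (c : R) : is_derive c 1 F (- (c / q) * F c).
  have cin : `]c - 1, c + 1[%classic c by rewrite /= in_itv/= ltrBlDr ltrDl ltr01.
  have p1 (a x : R) : partial1of2 f a x = - sin (a * x) * x * gauss_bell q x.
    by rewrite partial1of2E; apply: derive_val.
  have ub (a x : R) : `|partial1of2 f a x| <= `|x| * gauss_bell q x.
    rewrite p1 !normrM normrN (gtr0_norm (gauss_bell_gt0 q x)) -mulrA.
    by rewrite ler_piMl ?norm_sin_le1// mulr_ge0// gauss_bell_ge0.
  apply: DeriveDef.
    apply: (@derivable_under_integral _ _ _ leb f setT measurableT c (c - 1) (c + 1) cin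
      _ _ (fun x => `|x| * gauss_bell q x)) => //.
    - by move=> y; rewrite mulr_ge0// gauss_bell_ge0.
    - exact: integrable_moment1_gauss_bell.
  rewrite -derive1E (@differentiation_under_integral _ _ _ leb f setT measurableT c (c - 1) (c + 1) cin
      _ _ (fun x => `|x| * gauss_bell q x))//.
  - under eq_Rintegral do rewrite p1.
    have := gauss_bell_by_parts c q0.
    transitivity (- \int[leb]_x (sin (c * x) * x * gauss_bell q x)).
      rewrite -mulN1r -RintegralZl//.
      by apply: eq_Rintegral => x _; rewrite mulN1r !mulNr.
    move: H; under eq_Rintegral => x _.
      rewrite (_ : _ - _ = c * f c x - q * (sin (c * x) * x * gauss_bell q x)); last by rewrite /f; ring.
      over.
    rewrite RintegralB//; first last.
    - exact: (@integrableZl _ _ _ leb _ measurableT q _ (intxs c)).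
    - exact: (@integrableZl _ _ _ leb _ measurableT c _ (intf c)).
    rewrite (RintegralZl _ measurableT (intf c)) (RintegralZl _ measurableT (intxs c)).
    rewrite -/(F c) => /eqP; rewrite subr_eq0 => /eqP h.
    by rewrite mulNr mulrAC h mulrAC mulfV ?mul1r// gt_eqF.
  - by move=> y; rewrite mulr_ge0// gauss_bell_ge0.
  - exact: integrable_moment1_gauss_bell.
have const (c : R) : is_derive c 1 (fun c => F c * expR (c ^+ 2 / (2 * q))) 0.
  have d1 : is_derive c 1 (fun c => expR (c ^+ 2 / (2 * q))) (expR (c ^+ 2 / (2 * q)) * (c / q)).
    apply: (@is_derive1_comp _ expR (fun c => c ^+ 2 / (2 * q))).
    by apply: is_derive_eq; rewrite /GRing.scale/=; field; rewrite gt_eqF.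
  have d2 := is_deriveM (duf c) d1.
  by apply: (is_derive_eq d2); rewrite /GRing.scale/=; ring.
have := is_derive_0_is_cst b 0 const.
rewrite expr0n mul0r expR0 mulr1 {2}/F /f.
under [in X in _ = X -> _]eq_Rintegral do rewrite mul0r cos0 mul1r.
rewrite Rintegral_gauss_bell// => <-.
by rewrite mulrCA expRN mulVf ?mulr1// gt_eqF// expR_gt0.
Qed.

Lemma normal_expR_cos (r b : R) : 0 <= r ->
  \int[normal_prob 0 1]_w (expR (- (r * w ^+ 2 / 2)) * cos (b * w)) =
  (Num.sqrt (1 + r))^-1 * expR (- (b ^+ 2 / (2 * (1 + r)))).
Proof.
move=> r0; have r1 : 0 < 1 + r by rewrite ltr_pwDl.
have ib : (normal_prob (0 : R) 1).-integrable setT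
    (EFin \o (fun w => expR (- (r * w ^+ 2 / 2)) * cos (b * w))).
  apply: (@bounded_integrable _ _ _ _ _ 1).
    apply: measurable_funM; first exact: measurable_gauss_bell.
    apply: continuous_measurable_fun => x.
    by apply: continuous_comp; [exact: mulrl_continuous|exact: continuous_cos].
  move=> x; rewrite normrM (gtr0_norm (expR_gt0 _)) mulr_ile1 ?norm_cos_le1 ?expR_ge0//.
  by rewrite -[leRHS]expR0 ler_expR oppr_le0 divr_ge0// mulr_ge0// sqr_ge0.
rewrite /Rintegral (@integral_density _ _ _ _ leb (normal_pdf 0 1))//; first last.
- exact: normal_pdf_ge0.
- exact: measurable_normal_pdf.
pose k := (Num.sqrt (pi *+ 2))^-1 : R.
transitivity (\int[leb]_x (k * (cos (b * x) * gauss_bell (1 + r) x))).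
  apply: eq_Rintegral => x _.
  rewrite normal_pdfE ?oner_eq0// /normal_peak /normal_fun expr1n mul1r subr0 /gauss_bell.
  rewrite (_ : - ((1 + r) * x ^+ 2 / 2) = - (r * x ^+ 2 / 2) + - x ^+ 2 / (1 *+ 2)); last by field.
  by rewrite expRD -/k; ring.
rewrite RintegralZl//; last first.
  apply: (@le_integrable _ _ _ leb _ _ _ (EFin \o gauss_bell (1 + r))) => //.
  - apply/measurable_EFinP/measurable_funM; last exact: measurable_gauss_bell.
    apply: continuous_measurable_fun => x.
    by apply: continuous_comp; [exact: mulrl_continuous|exact: continuous_cos].
  - move=> x _ /=; rewrite lee_fin normrM ler_piMl// norm_cos_le1//.
  - exact: integrable_gauss_bell.
rewrite Rintegral_cos_gauss_bell// mulrCA mulrC; congr (_ * _).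
rewrite /k -mulrnAr sqrtrM ?invr_ge0 ?ltW// sqrtrV ?ltW// mulrCA mulVf ?mulr1//.
by rewrite gt_eqF// sqrtr_gt0 mulrn_wgt0// pi_gt0.
Qed.

End gaussian_cosine.

(** * Gaussian vectors *)

Section gaussian_mixture.
Context d (T : measurableType d) (R : realType) (P : probability T R).

Lemma cosM_cos (u v : R) : cos u * cos v = 2^-1 * (cos (u + v) + cos (u - v)).
Proof. by rewrite cosD cosB; field. Qed.

(* Write [exp (- a v ^ 2 / 2)] as the mean of [cos (sqrt a v W)] over a standard
   normal variable [W], and integrate over [W] last. *)
Lemma Rintegral_gaussian_step (F Y eta : T -> R) (k s a tau : R) :
  measurable_fun setT F -> measurable_fun setT Y -> measurable_fun setT eta ->
  (forall x, `|F x| <= 1) -> 0 <= s -> 0 <= a ->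
  (forall t th, \int[P]_x (F x * cos (Y x + t * eta x + th)) =
                k * expR (- (s * t ^+ 2 / 2)) * cos th) ->
  forall th,
  \int[P]_x (expR (- (a * (eta x - tau) ^+ 2 / 2)) * F x * cos (Y x + th)) =
  (Num.sqrt (1 + a * s))^-1 * expR (- (a * tau ^+ 2 / (2 * (1 + a * s)))) * k * cos th.
Proof.
move=> mF mY meta F1 s0 a0 H th.
pose f (z : T * R) := F z.1 * cos (Y z.1 + th) * cos (Num.sqrt a * (eta z.1 - tau) * z.2).
have mcos d' (U : measurableType d') (g : U -> R) :
    measurable_fun setT g -> measurable_fun setT (fun x => cos (g x)).
  move=> mg; apply: measurableT_comp => //.
  by apply: continuous_measurable_fun; exact: continuous_cos.
have mf : measurable_fun setT f.
  apply: measurable_funM; [apply: measurable_funM|].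
  - exact: measurableT_comp.
  - by apply: mcos; apply: measurable_funD => //; exact: measurableT_comp.
  - apply: mcos; apply: measurable_funM => //; apply: measurable_funM => //.
    by apply: measurable_funB => //; exact: measurableT_comp.
have f1 z : `|f z| <= 1.
  rewrite /f !normrM -[leRHS]mulr1 ler_pM ?norm_cos_le1 ?mulr_ge0//.
  by rewrite -[leRHS]mulr1 ler_pM ?norm_cos_le1.
transitivity (\int[P]_x \int[normal_prob 0 1]_w f (x, w)).
  apply: eq_Rintegral => x _; rewrite /f/= RintegralZl//; last first.
    apply: (@bounded_integrable _ _ _ _ _ 1); last by move=> w; exact: norm_cos_le1.
    by apply: mcos; exact: measurable_funM.
  have := @normal_expR_cos R 0 (Num.sqrt a * (eta x - tau)) (lexx _).
  under eq_Rintegral do rewrite !mul0r oppr0 expR0 mul1r.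
  move=> ->; rewrite !addr0 sqrtr1 invr1 mul1r mulr1 exprMn sqr_sqrtr//.
  by ring.
transitivity (\int[normal_prob 0 1]_w \int[P]_x f (x, w)).
  exact: (@Rintegral_Fubini_bounded _ _ _ _ _ P (normal_prob 0 1) f 1 mf f1).
under eq_Rintegral => w _.
  rewrite (_ : Rintegral _ _ _ = k * cos th *
      (expR (- (a * s * w ^+ 2 / 2)) * cos (Num.sqrt a * tau * w))); last first.
    pose g t th' x := F x * cos (Y x + t * eta x + th').
    have ig t th' : P.-integrable setT (EFin \o g t th').
      apply: (@bounded_integrable _ _ _ _ _ 1).
        apply: measurable_funM => //; apply: mcos; apply: measurable_funD => //.
        by apply: measurable_funD => //; apply: measurable_funM.
      by move=> x; rewrite /g normrM mulr_ile1 ?norm_cos_le1.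
    pose b := Num.sqrt a * w.
    transitivity (\int[P]_x (2^-1 * (g b (th - b * tau) x + g (- b) (th + b * tau) x))).
      apply: eq_Rintegral => x _; rewrite /f /g/= -mulrA cosM_cos /b.
      have -> : Y x + th + Num.sqrt a * (eta x - tau) * w =
        Y x + Num.sqrt a * w * eta x + (th - Num.sqrt a * w * tau) by ring.
      have -> : Y x + th - Num.sqrt a * (eta x - tau) * w =
        Y x + - (Num.sqrt a * w) * eta x + (th + Num.sqrt a * w * tau) by ring.
      by rewrite -mulrDr mulrCA.
    rewrite RintegralZl//; last first.
      exact: (integrableD measurableT (ig _ _) (ig _ _)).
    rewrite RintegralD ?ig// !H sqrrN.
    have -> : s * b ^+ 2 = a * s * w ^+ 2 by rewrite /b exprMn sqr_sqrtr//; ring.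
    rewrite cosB cosD (_ : b * tau = Num.sqrt a * tau * w); last by rewrite /b; ring.
    by field.
  over.
rewrite RintegralZl//; last first.
  apply: (@bounded_integrable _ _ _ _ _ 1).
    apply: measurable_funM; first exact: (measurable_gauss_bell (a * s)).
    by apply: mcos; exact: measurable_funM.
  move=> w; rewrite normrM mulr_ile1 ?norm_cos_le1// gtr0_norm ?expR_gt0//.
  by rewrite -[leRHS]expR0 ler_expR oppr_le0 divr_ge0//  mulr_ge0 ?sqr_ge0// mulr_ge0.
rewrite normal_expR_cos ?mulr_ge0// exprMn sqr_sqrtr//; ring.
Qed.

Lemma Rintegral_gaussian_prod n (eta : 'I_n -> T -> R) (s a tau : 'I_n -> R) :
  (forall i, measurable_fun setT (eta i)) ->
  (forall i, 0 <= s i) -> (forall i, 0 <= a i) ->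
  (forall (t : 'I_n -> R) th, \int[P]_x (cos (\sum_i t i * eta i x + th)) =
     expR (- (\sum_i s i * t i ^+ 2) / 2) * cos th) ->
  \int[P]_x (\prod_i expR (- (a i * (eta i x - tau i) ^+ 2 / 2))) =
  \prod_i ((Num.sqrt (1 + a i * s i))^-1 *
           expR (- (a i * tau i ^+ 2 / (2 * (1 + a i * s i))))).
Proof.
move=> meta s0 a0 H.
pose g i x := expR (- (a i * (eta i x - tau i) ^+ 2 / 2)).
pose k i := (Num.sqrt (1 + a i * s i))^-1 *
            expR (- (a i * tau i ^+ 2 / (2 * (1 + a i * s i)))).
have g1 i x : `|g i x| <= 1.
  rewrite gtr0_norm ?expR_gt0// -[leRHS]expR0 ler_expR oppr_le0 divr_ge0//.
  by rewrite mulr_ge0// sqr_ge0.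
have mg i : measurable_fun setT (g i).
  apply: (@measurableT_comp _ _ _ _ _ _ (gauss_bell (a i)) _ (fun x => eta i x - tau i)).
    exact: measurable_gauss_bell.
  exact: measurable_funB.
suff claim (r : seq 'I_n) : uniq r -> forall (t : 'I_n -> R) th,
    (forall i, i \in r -> t i = 0) ->
    \int[P]_x (\prod_(i <- r) g i x * cos (\sum_i t i * eta i x + th)) =
    \prod_(i <- r) k i * expR (- (\sum_i s i * t i ^+ 2) / 2) * cos th.
  have := claim (index_enum 'I_n) (index_enum_uniq _) (fun=> 0) 0 (fun _ _ => erefl).
  have -> : \sum_i s i * (0 : R) ^+ 2 = 0 by apply: big1 => i _; rewrite expr0n mulr0.
  rewrite oppr0 mul0r expR0 cos0 !mulr1 => <-.
  apply: eq_Rintegral => x _; rewrite (_ : \sum_i 0 * eta i x = 0) ?add0r ?cos0 ?mulr1//.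
  by apply: big1 => i _; rewrite mul0r.
elim: r => [_ t th _|i r IH /= /andP[ir ur] t th t0].
  under eq_Rintegral do rewrite big_nil mul1r.
  by rewrite H big_nil mul1r.
under eq_Rintegral do rewrite big_cons.
rewrite (@Rintegral_gaussian_step _ _ _
  (\prod_(j <- r) k j * expR (- (\sum_i s i * t i ^+ 2) / 2)) (s i))//.
- by rewrite big_cons /k; ring.
- by apply: measurable_prod => j _.
- by apply: measurable_sum => j; exact: measurable_funM.
- move=> x; rewrite normr_prod.
  suff /andP[] : 0 <= \prod_(j <- r) `|g j x| <= 1 by [].
  apply: (big_ind (fun u : R => 0 <= u <= 1)); first by rewrite ler01 lexx.
    by move=> u v /andP[u0 u1] /andP[v0 v1]; rewrite mulr_ge0//= mulr_ile1.
  by move=> j _; rewrite normr_ge0 g1.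
- move=> b th'.
  pose t' j := t j + (j == i)%:R * b.
  have e1 x : \sum_j t j * eta j x + b * eta i x = \sum_j t' j * eta j x.
    under [RHS]eq_bigr do rewrite mulrDl.
    rewrite big_split/=; congr (_ + _); rewrite (bigD1 i)//= eqxx mul1r big1 ?addr0//.
    by move=> j /negbTE ->; rewrite !mul0r.
  under eq_Rintegral do rewrite e1.
  rewrite (IH ur)//; last first.
    move=> j jr; rewrite /t' t0 ?inE ?jr ?orbT// (negbTE (_ : j != i)) ?mul0r ?addr0//.
    by apply: contraNneq ir => <-.
  have -> : \sum_j s j * t' j ^+ 2 = \sum_j s j * t j ^+ 2 + s i * b ^+ 2.
    rewrite (bigD1 i)//= [in RHS](bigD1 i)//= /t' eqxx t0 ?inE ?eqxx//.
    rewrite expr0n/= mulr0 add0r mul1r add0r addrC; congr (_ + _).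
    by apply: eq_bigr => j /negbTE ->; rewrite mul0r addr0.
  by rewrite opprD mulrDl expRD !mulNr; ring.
Qed.

End gaussian_mixture.

Section second_moment.
Context {R : realType}.
Implicit Types (a s A : R).

Lemma expRN_bounds (y : R) : 0 <= y -> y / (1 + y) <= 1 - expR (- y) <= y.
Proof.
move=> y0; have y1 : 0 < 1 + y by rewrite ltr_pwDl.
apply/andP; split; last by have := expR_ge1Dx (- y); lra.
have : expR (- y) <= (1 + y)^-1.
  by rewrite expRN lef_pV2 ?posrE ?expR_gt0// expR_ge1Dx.
have -> : y / (1 + y) = 1 - (1 + y)^-1 by field; rewrite gt_eqF.
lra.
Qed.

Lemma ln1D_ge (x : R) : 0 <= x -> x / (1 + x) <= ln (1 + x).
Proof.
move=> x0; have x1 : 0 < 1 + x by rewrite ltr_pwDl.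
have := @le_ln1Dx R (- (x / (1 + x))).
have -> : 1 + - (x / (1 + x)) = (1 + x)^-1 by field; rewrite gt_eqF.
rewrite lnV ?posrE//.
have h : -1 < - (x / (1 + x)).
  by rewrite ltrN2 ltr_pdivrMr// mul1r ltrDr.
by move=> /(_ h); rewrite lerN2.
Qed.

Lemma cvg_expR_quotient (y : R ^nat) s A : 0 <= s -> 0 <= A ->
  (forall n, 2^-1 ^+ n * A / (2 * (1 + 2^-1 ^+ n * s)) <= y n <= 2^-1 ^+ n * A / 2) ->
  (1 - expR (- y n)) * 2 / 2^-1 ^+ n @[n --> \oo] --> A.
Proof.
move=> s0 A0 Hy.
have a0 n : 0 < (2^-1 : R) ^+ n by rewrite exprn_gt0// invr_gt0.
have acvg : (2^-1 : R) ^+ n @[n --> \oo] --> 0.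
  by apply: cvg_expr; rewrite ger0_norm// invf_lt1 ?ltr1n.
pose l n := A / (1 + 2^-1 ^+ n * s) / (1 + 2^-1 ^+ n * (A / 2)).
have lcvg : l n @[n --> \oo] --> A.
  have D c : 1 + 2^-1 ^+ n * c @[n --> \oo] --> (1 : R).
    rewrite -[X in _ --> X](addr0 1) -[X in _ + X](mul0r c).
    by apply: cvgD; [exact: cvg_cst|apply: cvgM => //; exact: cvg_cst].
  rewrite -[X in _ --> X](divr1 A) -[X in _ --> X](divr1 (A / 1)).
  apply: cvgM; last by apply: cvgV => //; exact: oner_neq0.
  by apply: cvgM; [exact: cvg_cst|apply: cvgV => //; exact: oner_neq0].
apply: (@squeeze_cvgr _ _ _ _ l (fun=> A)) => //; last exact: cvg_cst.
near=> n; have {Hy}/andP[y1 y2] := Hy n; have {}a0 := a0 n.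
rewrite /l; set a := 2^-1 ^+ n in a0 y1 y2 *; clearbody a.
have as0 : 0 < 1 + a * s by rewrite ltr_pwDl// mulr_ge0// ltW.
have aA0 : 0 < 1 + a * (A / 2) by rewrite ltr_pwDl// mulr_ge0 ?divr_ge0// ltW.
have y0 : 0 <= y n.
  by apply: le_trans y1; rewrite divr_ge0 ?mulr_ge0// ltW.
have yp : 0 < 1 + y n by rewrite ltr_pwDl.
have /andP[e1 e2] := expRN_bounds y0.
apply/andP; split; last first.
  by rewrite ler_pdivrMr// -ler_pdivlMr// (le_trans e2)// (mulrC A).
rewrite ler_pdivlMr// -ler_pdivrMr// (le_trans _ e1)//.
have -> : A / (1 + a * s) / (1 + a * (A / 2)) * a / 2 =
    a * A / (2 * (1 + a * s)) / (1 + a * (A / 2)).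
  by field; rewrite !gt_eqF//; lra.
apply: ler_pM => //.
- by rewrite divr_ge0 ?mulr_ge0// ltW.
- by rewrite invr_ge0 ltW.
- by rewrite lef_pV2 ?posrE//; lra.
Unshelve. all: by end_near. Qed.

Context d (T : measurableType d) (P : probability T R).

(* Monotone convergence for [2 / a (1 - exp (- a v ^ 2 / 2))], which increases
   to [v ^ 2] along [a = 2 ^ - n]. *)
Lemma gaussian_second_moment (eta : T -> R) s tau :
  measurable_fun setT eta -> 0 <= s ->
  (forall t th, \int[P]_x (cos (t * eta x + th)) =
                expR (- (s * t ^+ 2 / 2)) * cos th) ->
  (\int[P]_x ((eta x - tau) ^+ 2)%:E = (s + tau ^+ 2)%:E)%E.
Proof.
move=> meta s0 H.
have a0 n : 0 < (2^-1 : R) ^+ n by rewrite exprn_gt0// invr_gt0.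
pose g n x := (1 - expR (- (2^-1 ^+ n * (eta x - tau) ^+ 2 / 2))) * 2 / 2^-1 ^+ n.
have y0 n x : 0 <= 2^-1 ^+ n * (eta x - tau) ^+ 2 / 2.
  by rewrite divr_ge0// mulr_ge0 ?sqr_ge0// ltW.
have mexp n : measurable_fun setT (fun x => expR (- (2^-1 ^+ n * (eta x - tau) ^+ 2 / 2))).
  apply: (@measurableT_comp _ _ _ _ _ _ (gauss_bell (2^-1 ^+ n)) _ (fun x => eta x - tau)).
    exact: measurable_gauss_bell.
  exact: measurable_funB.
have mg n : measurable_fun setT (g n).
  by apply: measurable_funM => //; apply: measurable_funM => //; exact: measurable_funB.
have g0 n x : 0 <= g n x.
  rewrite divr_ge0 ?mulr_ge0 ?subr_ge0 ?(ltW (a0 n))//.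
  by rewrite -[leRHS]expR0 ler_expR oppr_le0; exact: y0.
have gS n x : g n x <= g n.+1 x.
  rewrite /g; have := y0 n.+1 x; set v := (eta x - tau) ^+ 2.
  have {}a0 := a0 n; rewrite !exprS; set a := 2^-1 ^+ n in a0 *; clearbody a => v0.
  have -> : - (a * v / 2) = - (2^-1 * a * v / 2) + - (2^-1 * a * v / 2) by field.
  rewrite expRD; have := expR_gt0 (- (2^-1 * a * v / 2)).
  have : expR (- (2^-1 * a * v / 2)) <= 1 by rewrite -[leRHS]expR0 ler_expR oppr_le0; exact: v0.
  set e := expR _ => e1 e0.
  have -> : (1 - e) * 2 / (2^-1 * a) = (1 - e) * 4 / a by field; rewrite gt_eqF.
  by rewrite ler_pM2r ?invr_gt0//; nra.
have g_nd x : {homo (fun n => (g n x)%:E) : n m / (n <= m)%N >-> (n <= m)%E}.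
  by apply: homo_leq => [//|u v w|n]; [exact: le_trans|rewrite lee_fin].
have gcvg x : g n x @[n --> \oo] --> (eta x - tau) ^+ 2.
  apply: (@cvg_expR_quotient _ 0) => //; first exact: sqr_ge0.
  by move=> n; rewrite mulr0 addr0 mulr1 lexx.
have mono : (\int[P]_x (g n x)%:E)%E @[n --> \oo] -->
    (\int[P]_x limn (fun n => (g n x)%:E))%E.
  apply: cvg_monotone_convergence => //.
  - by move=> n; exact/measurable_EFinP.
  - by move=> n x _; rewrite lee_fin.
have lim_gE : (\int[P]_x limn (fun n => (g n x)%:E) = \int[P]_x ((eta x - tau) ^+ 2)%:E)%E.
  apply: eq_integral => x _; apply/cvg_lim => //.
  by apply: cvg_EFin; [exact: nearW|exact: gcvg].
rewrite lim_gE in mono.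
apply: (cvg_unique _ mono) => //.
pose yn n := ln (1 + 2^-1 ^+ n * s) / 2 + 2^-1 ^+ n * tau ^+ 2 / (2 * (1 + 2^-1 ^+ n * s)).
have EgE n : (\int[P]_x (g n x)%:E)%E = ((1 - expR (- yn n)) * 2 / 2^-1 ^+ n)%:E.
  have as0 : 0 < 1 + 2^-1 ^+ n * s by rewrite ltr_pwDl// mulr_ge0// ltW.
  have ie : P.-integrable setT (EFin \o (fun x => expR (- (2^-1 ^+ n * (eta x - tau) ^+ 2 / 2)))).
    apply: (@bounded_integrable _ _ _ _ _ 1) => // x.
    by rewrite gtr0_norm ?expR_gt0// -[leRHS]expR0 ler_expR oppr_le0; exact: y0.
  have i1 : P.-integrable setT (EFin \o (fun _ : T => (1 : R))).
    exact: finite_measure_integrable_cst.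
  have i2 := integrableB measurableT i1 ie.
  rewrite EFin_Rintegral; last first.
    apply: (@bounded_integrable _ _ _ _ _ (2 / 2^-1 ^+ n)) => // x.
    rewrite ger0_norm// /g ler_pM2r ?invr_gt0// ler_piMl//.
  congr EFin.
  under eq_Rintegral do rewrite /g -mulrA mulrC.
  rewrite RintegralZl// RintegralB// Rintegral_cst//.
  rewrite (_ : fine _ = 1) ?mulr1; last exact: (congr1 fine (probability_setT P)).
  rewrite -mulrA [RHS]mulrC; congr (_ * (_ - _)).
  have H1 (t : 'I_1 -> R) th : \int[P]_x cos (\sum_i t i * eta x + th) =
      expR (- (\sum_i s * t i ^+ 2) / 2) * cos th.
    by under eq_Rintegral do rewrite big_ord1; rewrite H big_ord1 mulNr.
  have := @Rintegral_gaussian_prod _ _ _ P 1 (fun=> eta) (fun=> s) (fun=> 2^-1 ^+ n)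
    (fun=> tau) (fun=> meta) (fun=> s0) (fun=> ltW (a0 n)) H1.
  under eq_Rintegral do rewrite big_ord1.
  move=> ->.
  rewrite big_ord1 /yn opprD expRD; congr (_ * _).
  rewrite expRN; congr (_^-1).
  rewrite -{1}(lnK (x := 1 + 2^-1 ^+ n * s)) ?posrE// [X in expR X](splitr) expRD -expr2.
  by rewrite sqrtr_sqr ger0_norm// expR_ge0.
rewrite (funext EgE).
apply: cvg_EFin; first exact: nearW.
apply: (@cvg_expR_quotient _ s) => //; first by rewrite addr_ge0// sqr_ge0.
move=> n; rewrite /yn; set a := 2^-1 ^+ n.
have {}a0 : 0 < a by exact: a0.
have as0 : 0 <= a * s by rewrite mulr_ge0// ltW.
have u0 : 0 <= a * tau ^+ 2 by rewrite mulr_ge0 ?sqr_ge0// ltW.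
have as1 : 0 < 1 + a * s by rewrite ltr_pwDl.
have l1 : a * s / (1 + a * s) <= ln (1 + a * s) by exact: ln1D_ge.
have l2 : ln (1 + a * s) <= a * s by rewrite le_ln1Dx// (lt_le_trans _ as0)// ltrN10.
have l3 : a * tau ^+ 2 / (1 + a * s) <= a * tau ^+ 2.
  by rewrite ler_pdivrMr// ler_peMr// lerDl.
have -> : a * (s + tau ^+ 2) / (2 * (1 + a * s)) =
    a * s / (1 + a * s) / 2 + a * tau ^+ 2 / (1 + a * s) / 2 by field; rewrite gt_eqF.
have -> : a * tau ^+ 2 / (2 * (1 + a * s)) = a * tau ^+ 2 / (1 + a * s) / 2.
  by field; rewrite gt_eqF.
by apply/andP; split; lra.
Qed.

End second_moment.

(** * Duality for entropic transport *)

Section density_measure.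
Local Open Scope ereal_scope.
Context d (T : measurableType d) (R : realType) (mu : {measure set T -> \bar R}).
Variable p : T -> R.
Hypotheses (mp : measurable_fun setT p) (p_ge0 : forall x, (0 <= p x)%R)
  (p1 : \int[mu]_x (p x)%:E = 1).

Let m (A : set T) : \bar R := \int[mu]_(x in A) (p x)%:E.

Let m0 : m set0 = 0. Proof. exact: integral_set0. Qed.

Let m_ge0 A : 0 <= m A.
Proof. by apply: integral_ge0 => x _; rewrite lee_fin. Qed.

Let m_sigma_additive : semi_sigma_additive m.
Proof.
move=> A mA tA mUA; rewrite /m ge0_integral_bigcup//; last 2 first.
- by apply/measurable_EFinP; exact: measurable_funTS.
- by move=> x _; rewrite lee_fin.
by apply: is_cvg_ereal_nneg_natsum_cond => n _ _; exact: m_ge0.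
Qed.

HB.instance Definition _ := isMeasure.Build _ _ _ m m0 m_ge0 m_sigma_additive.

Let m_setT : m setT = 1. Proof. exact: p1. Qed.

HB.instance Definition _ := @Measure_isProbability.Build _ _ R m m_setT.

Lemma density_probability : exists g : probability T R,
  forall A, measurable A -> g A = \int[mu]_(x in A) (p x)%:E.
Proof. by exists m. Qed.

End density_measure.

Section le_integral_minorant.
Local Open Scope ereal_scope.
Context d (T : measurableType d) (R : realType) (mu : {measure set T -> \bar R}).

Lemma le_integral_measurable (q f : T -> \bar R) :
  measurable_fun setT q -> measurable_fun setT f -> (forall x, q x <= f x) ->
  \int[mu]_x q x <= \int[mu]_x f x.
Proof.
move=> mq mf qf; rewrite integralE [leRHS]integralE; apply: leeB.
- apply: ge0_le_integral => //; [exact: measurable_funepos..|].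
  by move=> x _; apply: (@funepos_le _ _ setT); rewrite ?inE// => y _.
- apply: ge0_le_integral => //; [exact: measurable_funeneg..|].
  by move=> x _; apply: (@funeneg_le _ _ setT); rewrite ?inE// => y _.
Qed.

End le_integral_minorant.

Lemma gibbs_pointwise {R : realType} (f p : R) : 0 <= f -> 0 < p ->
  f * ln p + f - p <= f * ln f.
Proof.
rewrite le_eqVlt => /predU1P[<-|f0] p0; first by rewrite !mul0r addr0 sub0r oppr_le0 ltW.
have := @le_ln1Dx R (p / f - 1).
rewrite ltrBrDl subrr divr_gt0// => /(_ isT).
rewrite addrC subrK ln_div ?posrE// => h.
have := ler_wpM2l (ltW f0) h; rewrite !mulrBr mulrCA divff ?gt_eqF//; lra.
Qed.

Section coupling_theory.
Local Open Scope ereal_scope.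
Context {R : realType} {H : completeNormedModType R}.
Local Notation HB := (borel H).
Variables (mu nu : probability HB R) (g : probability (HB * HB)%type R).
Hypothesis gE : couplings mu nu g.

Lemma ge0_integral_fst (h : HB -> \bar R) : measurable_fun setT h ->
  (forall x, 0 <= h x) -> \int[g]_z h z.1 = \int[mu]_x h x.
Proof.
move=> mh h0.
transitivity (\int[pushforward g (fst : HB * HB -> HB)]_x h x).
  by rewrite ge0_integral_pushforward// => x _.
apply: eq_measure_integral => A mA _.
transitivity (g (A `*` setT)); last exact: (gE mA).1.
rewrite /= /pushforward; congr (g _).
by apply/seteqP; split => [[x y]|[x y] []].
Qed.

Lemma ge0_integral_snd (h : HB -> \bar R) : measurable_fun setT h ->
  (forall x, 0 <= h x) -> \int[g]_z h z.2 = \int[nu]_x h x.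
Proof.
move=> mh h0.
transitivity (\int[pushforward g (snd : HB * HB -> HB)]_x h x).
  by rewrite ge0_integral_pushforward// => x _.
apply: eq_measure_integral => A mA _.
transitivity (g (setT `*` A)); last exact: (gE mA).2.
rewrite /= /pushforward; congr (g _).
by apply/seteqP; split => [[x y]|[x y] []].
Qed.

Lemma integrable_fst (h : HB -> R) : mu.-integrable setT (EFin \o h) ->
  g.-integrable setT (fun z => (h z.1)%:E) /\ \int[g]_z (h z.1)%:E = \int[mu]_x (h x)%:E.
Proof.
move=> /integrableP[mh ih]; split.
  apply/integrableP; split; first exact: (measurableT_comp mh).
  rewrite (@ge0_integral_fst (fun x => `|(h x)%:E|))//.
  exact: measurableT_comp.
rewrite integralE [RHS]integralE; congr (_ - _).
- by rewrite -(ge0_integral_fst (measurable_funepos mh))//; apply: eq_integral => z _; rewrite !funeposE.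
- by rewrite -(ge0_integral_fst (measurable_funeneg mh))//; apply: eq_integral => z _; rewrite !funenegE.
Qed.

Lemma integrable_snd (h : HB -> R) : nu.-integrable setT (EFin \o h) ->
  g.-integrable setT (fun z => (h z.2)%:E) /\ \int[g]_z (h z.2)%:E = \int[nu]_x (h x)%:E.
Proof.
move=> /integrableP[mh ih]; split.
  apply/integrableP; split; first exact: (measurableT_comp mh).
  rewrite (@ge0_integral_snd (fun x => `|(h x)%:E|))//.
  exact: measurableT_comp.
rewrite integralE [RHS]integralE; congr (_ - _).
- by rewrite -(ge0_integral_snd (measurable_funepos mh))//; apply: eq_integral => z _; rewrite !funeposE.
- by rewrite -(ge0_integral_snd (measurable_funeneg mh))//; apply: eq_integral => z _; rewrite !funenegE.
Qed.

Lemma coupling_ae (E0 E1 : set HB) : measurable E0 -> measurable E1 ->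
  mu E0 = 1 -> nu E1 = 1 -> {ae g, forall z, E0 z.1 /\ E1 z.2}.
Proof.
move=> mE0 mE1 E01 E11.
have h1 : g.-negligible (~` (E0 `*` setT)).
  exists (~` (E0 `*` setT)); split => //; first by apply: measurableC; exact: measurableX.
  by rewrite probability_setC ?(gE mE0).1 ?E01 ?subee//; exact: measurableX.
have h2 : g.-negligible (~` (setT `*` E1)).
  exists (~` (setT `*` E1)); split => //; first by apply: measurableC; exact: measurableX.
  by rewrite probability_setC ?(gE mE1).2 ?E11 ?subee//; exact: measurableX.
apply: negligibleS (negligibleU h1 h2) => z /= /not_andP[] zE; [left|right].
  by apply: contra_not zE => -[].
by apply: contra_not zE => -[].
Qed.

End coupling_theory.

Lemma ae_eq_integrable d (T : measurableType d) (R : realType)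
    (mu : {measure set T -> \bar R}) (f h : T -> \bar R) :
  measurable_fun setT f -> mu.-integrable setT h -> ae_eq mu setT f h ->
  mu.-integrable setT f.
Proof.
move=> mf ih fh; have [mh ihy] := integrableP _ _ _ ih.
apply/integrableP; split => //.
rewrite (ae_eq_integral (fun x => `|h x|)%E)//; try exact: measurableT_comp.
by apply: filterS fh => x fhx xT; rewrite fhx.
Qed.

Section eot_duality.
Context {R : realType} {H : completeNormedModType R}.
Local Notation HB := (borel H).
Variables (mu nu : probability HB R) (eps : R) (p : HB * HB -> R)
  (phi psi : HB -> R) (E0 E1 : set HB).
Let c (z : HB * HB) : R := `|(z.1 : H) - (z.2 : H)| ^+ 2.
Hypotheses (eps_gt0 : 0 < eps) (mp : measurable_fun setT p) (p_gt0 : forall z, 0 < p z)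
  (mc : measurable_fun setT c)
  (iphi : mu.-integrable setT (EFin \o phi)) (ipsi : nu.-integrable setT (EFin \o psi))
  (isq0 : mu.-integrable setT (fun x : HB => (`|x : H| ^+ 2)%:E))
  (isq1 : nu.-integrable setT (fun x : HB => (`|x : H| ^+ 2)%:E))
  (mE0 : measurable E0) (mE1 : measurable E1) (muE0 : mu E0 = 1%E) (nuE1 : nu E1 = 1%E)
  (p_fst : forall x, (\int[nu]_y (p (x, y))%:E = 1)%E)
  (p_snd : forall y, (\int[mu]_x (p (x, y))%:E = 1)%E)
  (p_key : forall x y, E0 x -> E1 y -> eps * ln (p (x, y)) + c (x, y) = phi x + psi y).

Let V := \int[mu]_x phi x + \int[nu]_x psi x.

Lemma coupling_identity (g : probability (HB * HB)%type R) : couplings mu nu g ->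
  [/\ g.-integrable setT (EFin \o c), g.-integrable setT (EFin \o (@ln R \o p))
    & eps * \int[g]_z ln (p z) + \int[g]_z c z = V].
Proof.
move=> gE.
have ic : g.-integrable setT (EFin \o c).
  have [i0 _] := integrable_fst gE isq0; have [i1 _] := integrable_snd gE isq1.
  apply: (@le_integrable _ _ _ g _ measurableT _
    (fun z => 2%:E * (`|z.1 : H| ^+ 2)%:E + 2%:E * (`|z.2 : H| ^+ 2)%:E)%E).
  - exact/measurable_EFinP.
  - move=> z _ /=; rewrite lee_fin ger0_norm ?sqr_ge0//.
    rewrite ger0_norm ?addr_ge0 ?mulr_ge0 ?sqr_ge0//.
    have h := ler_normB (z.1 : H) (z.2 : H).
    apply: (@le_trans _ _ ((`|z.1 : H| + `|z.2 : H|) ^+ 2)).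
      by rewrite ler_sqr ?nnegrE ?addr_ge0.
    have := sqr_ge0 (`|z.1 : H| - `|z.2 : H|); nra.
  - by apply: integrableD => //; exact: integrableZl.
have [iphi' phiE] := integrable_fst gE iphi; have [ipsi' psiE] := integrable_snd gE ipsi.
pose r z := (phi z.1 + psi z.2 - c z) / eps.
have ipp : g.-integrable setT (EFin \o (fun z => phi z.1 + psi z.2)).
  exact: (integrableD measurableT iphi' ipsi').
have ippc : g.-integrable setT (EFin \o (fun z => phi z.1 + psi z.2 - c z)).
  exact: (integrableB measurableT ipp ic).
have ir : g.-integrable setT (EFin \o r).
  apply: (eq_integrable _ (fun z => (eps^-1)%:E * ((phi z.1)%:E + (psi z.2)%:E - (c z)%:E))%E) => //.
    by move=> z _; rewrite /r /= mulrC.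
  exact: integrableZl.
have rE : ae_eq g setT (EFin \o (@ln R \o p)) (EFin \o r).
  apply: filterS (coupling_ae gE mE0 mE1 muE0 nuE1) => -[x y] [/= xE yE] _.
  rewrite /r /= -(p_key xE yE) addrK mulrAC mulfV ?mul1r//.
  by rewrite gt_eqF.
have mlnp : measurable_fun setT (EFin \o (@ln R \o p)).
  by apply/measurable_EFinP; apply: measurableT_comp => //; exact: measurable_ln.
have ilnp := ae_eq_integrable mlnp ir rE.
split=> //.
have -> : \int[g]_z ln (p z) = \int[g]_z r z.
  rewrite /Rintegral (ae_eq_integral (EFin \o r))//.
  by case/integrableP: ir.
have -> : \int[g]_z r z = eps^-1 * \int[g]_z (phi z.1 + psi z.2 - c z).
  transitivity (\int[g]_z (eps^-1 * (phi z.1 + psi z.2 - c z))).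
    by apply: eq_Rintegral => z _; rewrite /r mulrC.
  exact: (RintegralZl _ measurableT ippc).
rewrite mulrA mulfV ?gt_eqF// mul1r (RintegralB measurableT ipp ic) subrK.
rewrite (RintegralD measurableT iphi' ipsi') /V; congr (_ + _).
- by rewrite /Rintegral phiE.
- by rewrite /Rintegral psiE.
Qed.

Lemma OTeps_dual : OTeps eps mu nu = V%:E.
Proof.
have ge0p z : 0 <= p z by exact: ltW.
have mpE : measurable_fun setT (EFin \o p) by exact/measurable_EFinP.
have pA1 (A : set HB) : measurable A ->
    (\int[(mu \x nu)%E]_(z in A `*` setT) (p z)%:E = mu A)%E.
  move=> mA; rewrite integral_mkcond.
  transitivity (\int[(mu \x nu)%E]_z ((\1_A z.1 : R)%:E * (p z)%:E))%E.
    apply: eq_integral => -[x y] _; rewrite patchE indicE /=.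
    have [xA|xA] := boolP (x \in A).
      by rewrite ifT ?mul1e//; rewrite inE/=; split=> //; rewrite inE in xA.
    by rewrite ifF ?mul0e//; apply/negbTE; rewrite notin_setE => -[]; move: xA; rewrite notin_setE.
  have mh : measurable_fun setT (fun z : HB * HB => ((\1_A z.1 : R)%:E * (p z)%:E)%E).
    apply: emeasurable_funM => //; apply/measurable_EFinP.
    exact: (measurableT_comp (measurable_indic mA) measurable_fst).
  rewrite (@fubini_tonelli1 _ _ _ _ _ mu nu _ mh); last first.
    by move=> z; rewrite mule_ge0// lee_fin.
  rewrite /fubini_F /=.
  transitivity (\int[mu]_x (\1_A x : R)%:E)%E; last by rewrite integral_indic// setIT.
  apply: eq_integral => x _; rewrite ge0_integralZl//; last 2 first.
  - exact: (measurableT_comp mpE (pair1_measurable x)).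
  - by move=> y _; rewrite lee_fin.
  by rewrite p_fst mule1.
have pA2 (A : set HB) : measurable A ->
    (\int[(mu \x nu)%E]_(z in setT `*` A) (p z)%:E = nu A)%E.
  move=> mA; rewrite integral_mkcond.
  transitivity (\int[(mu \x nu)%E]_z ((\1_A z.2 : R)%:E * (p z)%:E))%E.
    apply: eq_integral => -[x y] _; rewrite patchE indicE /=.
    have [xA|xA] := boolP (y \in A).
      by rewrite ifT ?mul1e//; rewrite inE/=; split=> //; rewrite inE in xA.
    by rewrite ifF ?mul0e//; apply/negbTE; rewrite notin_setE => -[_]; move: xA; rewrite notin_setE.
  have mh : measurable_fun setT (fun z : HB * HB => ((\1_A z.2 : R)%:E * (p z)%:E)%E).
    apply: emeasurable_funM => //; apply/measurable_EFinP.
    exact: (measurableT_comp (measurable_indic mA) measurable_snd).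
  rewrite (@fubini_tonelli2 _ _ _ _ _ mu nu _ mh); last first.
    by move=> z; rewrite mule_ge0// lee_fin.
  rewrite /fubini_G /=.
  transitivity (\int[nu]_x (\1_A x : R)%:E)%E; last by rewrite integral_indic// setIT.
  apply: eq_integral => y _; rewrite ge0_integralZl//; last 2 first.
  - exact: (measurableT_comp mpE (pair2_measurable y)).
  - by move=> x _; rewrite lee_fin.
  by rewrite p_snd mule1.
have p1 : (\int[(mu \x nu)%E]_z (p z)%:E = 1)%E.
  by rewrite -setXTT pA1//; exact: probability_setT.
have costE g : couplings mu nu g -> sqdist_cost g = (\int[g]_z c z)%:E.
  by move=> /coupling_identity[ic _ _]; rewrite -EFin_Rintegral.
apply/eqP; rewrite eq_le; apply/andP; split.
- have [g gd] := density_probability mp ge0p p1.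
  have gE : couplings mu nu g.
    move=> A mA; split.
    + by rewrite gd ?pA1//; exact: measurableX.
    + by rewrite gd ?pA2//; exact: measurableX.
  have [ic il <-] := coupling_identity gE.
  apply: ge_ereal_inf; exists (sqdist_cost g + eps%:E * KL g (mu \x nu)%E)%E.
    by exists g.
  rewrite costE// EFinD addeC; apply: leeD => //.
  rewrite EFinM; apply: lee_wpmul2l; first by rewrite lee_fin ltW.
  rewrite -EFin_Rintegral//.
  apply: ereal_inf_lbound; exists p.
    by split.
  rewrite (@integral_density _ _ _ g (mu \x nu : probability _ _)%E p)//.
  by apply: eq_integral => z _; rewrite mulrC.
- apply/ereal_infP => _ [g gE <-]; have [ic il <-] := coupling_identity gE.
  rewrite costE// EFinD addeC; apply: leeD => //.
  rewrite EFinM; apply: lee_wpmul2l; first by rewrite lee_fin ltW.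
  apply/ereal_infP => _ [f [mf f0 gd] <-].
  pose p0 := (mu \x nu : probability (HB * HB)%type R)%E.
  have i1 := @integrable_density_mul _ _ _ g p0 f mf f0 gd (@ln R \o p) il.
  have i2 := @integrable_density _ _ _ g p0 f mf f0 gd.
  have i3 : p0.-integrable setT (EFin \o p).
    apply/integrableP; split; first exact/measurable_EFinP.
    by under eq_integral do rewrite /= ger0_norm//; rewrite p1 ltry.
  have i12 := integrableD measurableT i1 i2.
  apply: (@le_trans _ _ (\int[p0]_z (ln (p z) * f z + f z - p z)%:E)%E); last first.
    apply: le_integral_measurable.
    + apply/measurable_EFinP; apply: measurable_funB => //; apply: measurable_funD => //.
      by apply: measurable_funM => //; apply: measurableT_comp => //; exact: measurable_ln.
    + apply/measurable_EFinP; apply: measurable_funM => //.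
      by apply: measurableT_comp => //; exact: measurable_ln.
    + by move=> z; rewrite lee_fin (mulrC (ln _)); exact: gibbs_pointwise.
  rewrite -EFin_Rintegral// (@integral_density _ _ _ g p0 f)//.
  have fT : (\int[p0]_z (f z)%:E = 1)%E by rewrite -gd// probability_setT.
  rewrite [leRHS](integralB_EFin measurableT i12 i3) /= p1.
  rewrite (integralD_EFin measurableT i1 i2) /= fT.
  by rewrite addeK.
Qed.

End eot_duality.

(** * Hilbert spaces and Borel measurability *)

Section inner_product_theory.
Context {R : realType} {H : normedModType R} (ip : H -> H -> R).
Hypothesis ipP : inner_product ip.
Implicit Types (x y z : H) (a : R).

Lemma ipC x y : ip x y = ip y x. Proof. by case: ipP. Qed.

Lemma ip_norm x : ip x x = `|x| ^+ 2. Proof. by case: ipP. Qed.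

Lemma ipDl x y z : ip (x + y) z = ip x z + ip y z.
Proof. by case: ipP => _ h _; rewrite -[x in LHS]scale1r h mul1r. Qed.

Lemma ip0l z : ip 0 z = 0.
Proof. by apply: (@addrI _ (ip 0 z)); rewrite -ipDl !addr0. Qed.

Lemma ipZl a x z : ip (a *: x) z = a * ip x z.
Proof. by case: ipP => _ h _; rewrite -[a *: x]addr0 h ip0l addr0. Qed.

Lemma ipNl x z : ip (- x) z = - ip x z.
Proof. by rewrite -scaleN1r ipZl mulN1r. Qed.

Lemma ipBl x y z : ip (x - y) z = ip x z - ip y z.
Proof. by rewrite ipDl ipNl. Qed.

Lemma ipDr x y z : ip z (x + y) = ip z x + ip z y.
Proof. by rewrite ipC ipDl !(ipC z). Qed.

Lemma ipZr a x z : ip z (a *: x) = a * ip z x.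
Proof. by rewrite ipC ipZl (ipC z). Qed.

Lemma ipBr x y z : ip z (x - y) = ip z x - ip z y.
Proof. by rewrite ipC ipBl !(ipC z). Qed.

Lemma ip_suml I (r : seq I) (P : pred I) (F : I -> H) z :
  ip (\sum_(i <- r | P i) F i) z = \sum_(i <- r | P i) ip (F i) z.
Proof. by apply: (big_morph (ip^~ z)) => [x y|]; [exact: ipDl|exact: ip0l]. Qed.

Lemma ip_sumr I (r : seq I) (P : pred I) (F : I -> H) z :
  ip z (\sum_(i <- r | P i) F i) = \sum_(i <- r | P i) ip z (F i).
Proof. by rewrite ipC ip_suml; apply: eq_bigr => i _; rewrite ipC. Qed.

Lemma ip_polar x y : ip x y = (`|x + y| ^+ 2 - `|x| ^+ 2 - `|y| ^+ 2) / 2.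
Proof. by rewrite -!ip_norm ipDl !ipDr (ipC y x); field. Qed.

Lemma continuous_ip y : continuous (ip^~ y).
Proof.
move=> x; rewrite (_ : ip^~ y = fun x => (`|x + y| ^+ 2 - `|x| ^+ 2 - `|y| ^+ 2) / 2); last first.
  by apply/funext => z; exact: ip_polar.
have cN : {for x, continuous (fun z : H => `|z|)} by exact: norm_continuous.
have cND : {for x, continuous (fun z : H => `|z + y|)}.
  apply: continuous_comp; last exact: norm_continuous.
  by apply: cvgD; [exact: cvg_id|exact: cvg_cst].
apply: cvgM; last exact: cvg_cst.
apply: cvgB; last exact: cvg_cst.
by apply: cvgB; apply: cvgM.
Qed.

End inner_product_theory.

Section borel_measurability.
Context {R : realType} {H : normedModType R}.
Local Notation HB := (borel H).

Lemma borel_open_measurable (A : set H) : open A -> measurable (A : set HB).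
Proof. by move=> oA; exact: sub_sigma_algebra. Qed.

Lemma continuous_borel_measurable (f : H -> R) : continuous f ->
  measurable_fun setT (f : HB -> R).
Proof.
move=> /continuousP cf; apply: (measurability _ (RGenOpens.measurableE R)).
move=> _ [_ [a [b ->] <-]]; rewrite setTI.
by apply: borel_open_measurable; apply: cf; exact: interval_open.
Qed.

Variable s : nat -> H.
Hypothesis s_dense : forall (v : H) (e : R), 0 < e -> exists n, `|v - s n| < e.

Lemma dist_lt_dense (x y : H) (r : R) :
  `|x - y| < r <-> exists n, `|x - s n| + `|y - s n| < r.
Proof.
split=> [xyr|[n]]; last first.
  have := ler_normD (x - s n) (s n - y).
  by rewrite addrA subrK (distrC (s n)); lra.
have e0 : 0 < (r - `|x - y|) / 2 by rewrite divr_gt0// subr_gt0.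
have [n xn] := s_dense x e0; exists n.
have := ler_normD (y - x) (x - s n).
rewrite addrA subrK (distrC y x); lra.
Qed.

Lemma measurable_dist : measurable_fun setT (fun z : HB * HB => `|(z.1 : H) - (z.2 : H)|).
Proof.
apply: (measurability _ (RGenInftyO.measurableE R)).
move=> _ [_ [r ->] <-]; rewrite setTI.
rewrite (_ : _ @^-1` _ = \bigcup_n ((fun z : HB * HB => `|(z.1 : H) - s n| + `|(z.2 : H) - s n|) @^-1` `]-oo, r[)).
  apply: bigcupT_measurable => n; rewrite -[X in measurable X]setTI.
  have mn : measurable_fun setT ((fun x : H => `|x - s n|) : HB -> R).
    apply: continuous_borel_measurable => x.
    apply: (@continuous_comp _ _ _ (fun x : H => x - s n) (fun y : H => `|y|));
      last exact: norm_continuous.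
    by apply: cvgB; [exact: cvg_id|exact: cvg_cst].
  have mf : measurable_fun setT (fun z : HB * HB => `|(z.1 : H) - s n| + `|(z.2 : H) - s n|).
    apply: measurable_funD.
    - exact: (measurableT_comp mn measurable_fst).
    - exact: (measurableT_comp mn measurable_snd).
  by apply: mf => //; exact: measurable_itv.
apply/seteqP; split=> [[x y]|[x y] [n _]] /=; rewrite !in_itv/=.
  by move=> /dist_lt_dense[n xyn]; exists n => //=; rewrite in_itv.
by move=> xyn; apply/dist_lt_dense; exists n.
Qed.

Lemma dense_orthogonal (ip : H -> H -> R) (w : H) : inner_product ip ->
  (forall n, ip w (s n) = 0) -> w = 0.
Proof.
move=> ipP w0; apply/eqP; rewrite -normr_le0 leNgt; apply/negP => wgt0.
have [n] := s_dense w wgt0; apply/negP; rewrite -leNgt.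
rewrite -ler_sqr ?nnegrE// -!(ip_norm ipP) (ipBl ipP) !(ipBr ipP).
by rewrite (ipC ipP (s n) w) w0 subr0 sub0r opprK lerDl (ip_norm ipP) sqr_ge0.
Qed.

End borel_measurability.

Section rkhs_separable.
Context {R : realType} (X : pseudoMetricType R) (K : X -> X -> R).
Context (H : completeNormedModType R) (ip : H -> H -> R) (Phi : X -> H).
Hypotheses (sepX : separable_space X) (Kcont : continuous (fun p : X * X => K p.1 p.2))
  (HK : rkhs_feature_map K ip Phi).

Let ipP : inner_product ip. Proof. by case: HK. Qed.

Lemma feature_dist x x' : `|Phi x - Phi x'| ^+ 2 = K x x - 2 * K x x' + K x' x'.
Proof.
have [_ hK _] := HK.
rewrite -(ip_norm ipP) (ipBl ipP) !(ipBr ipP) !hK (_ : K x' x = K x x'); last first.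
  by rewrite -!hK (ipC ipP).
by ring.
Qed.

Lemma feature_dense (D : set X) : closure D = setT -> forall x (e : R), 0 < e ->
  exists2 x', D x' & `|Phi x - Phi x'| < e.
Proof.
move=> Dd x e e0.
have cf : (fun x' => K x x - 2 * K x x' + K x' x') @ x --> K x x - 2 * K x x + K x x.
  have c1 : K x x' @[x' --> x] --> K x x.
    apply: (@continuous_comp _ _ _ (fun x' => (x, x')) (fun p : X * X => K p.1 p.2));
      last exact: Kcont.
    by apply: cvg_pair; [exact: cvg_cst|exact: cvg_id].
  have c2 : K x' x' @[x' --> x] --> K x x.
    apply: (@continuous_comp _ _ _ (fun x' => (x', x')) (fun p : X * X => K p.1 p.2));
      last exact: Kcont.
    by apply: cvg_pair; exact: cvg_id.
  by apply: cvgD => //; apply: cvgB; [exact: cvg_cst|apply: cvgM; [exact: cvg_cst|]].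
rewrite (_ : K x x - 2 * K x x + K x x = 0) in cf; last by ring.
have e20 : 0 < e ^+ 2 by rewrite exprn_gt0.
have := cf _ (nbhsx_ballx (0 : R) _ e20).
rewrite /= nbhs_simpl /= => nx.
have : closure D x by rewrite Dd.
move=> /(_ _ nx)[x' [Dx' /=]]; rewrite /ball/= sub0r normrN => hx.
exists x' => //; rewrite -ltr_sqr ?nnegrE//; last exact: ltW.
by rewrite feature_dist (le_lt_trans _ hx)// ler_norm.
Qed.

Lemma rkhs_dense_seq : exists s : nat -> H,
  forall (v : H) (e : R), 0 < e -> exists n, `|v - s n| < e.
Proof.
have [D [/countable_injP[f finj] Dd]] := sepX.
pose Psi k : H := xget 0 [set h | exists x, [/\ D x, f x = k & h = Phi x]].
have PsiE x : D x -> Psi (f x) = Phi x.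
  move=> Dx; apply: xget_unique => [|h [x' [Dx' fx' ->]]]; first by exists x.
  by congr Phi; apply: finj; rewrite ?inE.
pose val (l : seq (rat * nat)) : H := \sum_(q <- l) ratr q.1 *: Psi q.2.
pose approx v := forall e : R, 0 < e -> exists l, `|v - val l| < e.
have approxD v w : approx v -> approx w -> approx (v + w).
  move=> av aw e e0; have e20 : 0 < e / 2 by rewrite divr_gt0.
  have [l1 h1] := av _ e20; have [l2 h2] := aw _ e20; exists (l1 ++ l2).
  rewrite /val big_cat/= opprD addrACA (le_lt_trans (ler_normD _ _))// [ltRHS]splitr.
  exact: ltrD.
have approxZ a v : approx v -> approx (a *: v).
  move=> av e e0.
  have a10 : 0 < `|a| + 1 by rewrite ltr_wpDl.
  have ea0 : 0 < e / 2 / (`|a| + 1) by rewrite !divr_gt0.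
  have [l hl] := av _ ea0.
  have l10 : 0 < `|val l| + 1 by rewrite ltr_wpDl.
  have el0 : 0 < e / 2 / (`|val l| + 1) by rewrite !divr_gt0.
  have [q] : exists q, (ratr q : R) \in `]a, a + e / 2 / (`|val l| + 1)[.
    by apply: rat_in_itvoo; rewrite ltrDl.
  rewrite in_itv/= => /andP[aq qa].
  exists [seq (q * p.1, p.2) | p <- l].
  have -> : val [seq (q * p.1, p.2) | p <- l] = ratr q *: val l.
    rewrite /val big_map scaler_sumr; apply: eq_bigr => p _ /=.
    by rewrite rmorphM scalerA.
  have -> : a *: v - ratr q *: val l = a *: (v - val l) + (a - ratr q) *: val l.
    by rewrite scalerBr scalerBl addrA subrK.
  rewrite (le_lt_trans (ler_normD _ _))// [ltRHS]splitr !normrZ.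
  apply: ler_ltD.
    rewrite (le_trans (ler_wpM2l (normr_ge0 _) (ltW hl)))//.
    by rewrite mulrCA ler_piMr ?divr_ge0 ?(ltW e0)// ler_pdivrMr// mul1r lerDl.
  rewrite ler0_norm ?subr_le0 ?(ltW aq)// opprB.
  apply: (@le_lt_trans _ _ ((e / 2 / (`|val l| + 1)) * `|val l|)).
    by rewrite ler_wpM2r// lerBlDl ltW.
  by rewrite -mulrA gtr_pMr ?divr_gt0// mulrC ltr_pdivrMr// mul1r ltrDl.
have approxPhi x : approx (Phi x).
  move=> e e0; have [x' Dx' hx] := feature_dense Dd x e0.
  exists [:: (1, f x')]; rewrite /val big_seq1 /= rmorph1 scale1r PsiE//.
have approx_span v : lspan Phi v -> approx v.
  move=> [n [c [x ->]]]; apply: (big_ind approx) => //.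
  - by move=> e e0; exists [::]; rewrite /val big_nil subr0 normr0.
  - by move=> i _; exact/approxZ.
have approx_all v : approx v.
  move=> e e0; have e20 : 0 < e / 2 by rewrite divr_gt0.
  have : closure (lspan Phi) v by case: HK => _ _ ->.
  move=> /(_ _ (nbhsx_ballx v _ e20))[w [/approx_span/(_ _ e20)[l hl]]].
  rewrite -ball_normE /= => vw; exists l.
  have := ler_normD (v - w) (w - val l); rewrite addrA subrK; lra.
exists (fun n => val (odflt [::] (unpickle n))) => v e e0.
by have [l hl] := approx_all v e e0; exists (pickle l); rewrite pickleK.
Qed.

End rkhs_separable.

(** * Gaussian measures on a Hilbert space *)

Section has_mean.
Context d (T : measurableType d) (R : realType) (P : probability T R).
Implicit Types (f g : T -> R) (u v : R).

Definition has_mean f v := P.-integrable setT (EFin \o f) /\ \int[P]_x f x = v.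

Lemma has_mean_cst v : has_mean (fun=> v) v.
Proof.
split; first exact: finite_measure_integrable_cst.
rewrite Rintegral_cst// (_ : fine _ = 1) ?mulr1//.
exact: (congr1 fine (probability_setT P)).
Qed.

Lemma has_meanD f g u v : has_mean f u -> has_mean g v ->
  has_mean (fun x => f x + g x) (u + v).
Proof.
move=> [fi <-] [gi <-]; split; first exact: (integrableD measurableT fi gi).
exact: RintegralD.
Qed.

Lemma has_meanZ a f u : has_mean f u -> has_mean (fun x => a * f x) (a * u).
Proof.
move=> [fi <-]; split; last exact: RintegralZl.
exact: (@integrableZl _ _ _ P _ measurableT a _ fi).
Qed.

Lemma has_mean_sum I (r : seq I) (F : I -> T -> R) (V : I -> R) :
  (forall i, has_mean (F i) (V i)) ->
  has_mean (fun x => \sum_(i <- r) F i x) (\sum_(i <- r) V i).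
Proof.
move=> FV; elim: r => [|i r IH].
  rewrite big_nil (_ : (fun x => _) = fun=> 0); first exact: has_mean_cst.
  by apply/funext => x; rewrite big_nil.
rewrite big_cons (_ : (fun x => _) = fun x => F i x + \sum_(j <- r) F j x).
  exact: has_meanD.
by apply/funext => x; rewrite big_cons.
Qed.

Lemma has_mean_ae f g v : measurable_fun setT f -> {ae P, forall x, f x = g x} ->
  has_mean g v -> has_mean f v.
Proof.
move=> mf fg [gi <-].
have fgE : ae_eq P setT (EFin \o f) (EFin \o g) by apply: filterS fg => x /= -> _.
have mg := measurable_int _ gi.
split; first by apply: ae_eq_integrable fgE => //; exact/measurable_EFinP.
by rewrite /Rintegral (ae_eq_integral (EFin \o g))//; exact/measurable_EFinP.
Qed.

Lemma has_mean_ge0 f v : measurable_fun setT f -> (forall x, 0 <= f x) ->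
  (\int[P]_x (f x)%:E = v%:E)%E -> has_mean f v.
Proof.
move=> mf f0 fv; split; last by rewrite /Rintegral fv.
apply/integrableP; split; first exact/measurable_EFinP.
by under eq_integral do rewrite /= ger0_norm//; rewrite fv ltry.
Qed.

Lemma gaussian_has_mean (eta : T -> R) s : measurable_fun setT eta -> 0 <= s ->
  (forall t th, \int[P]_x (cos (t * eta x + th)) =
                expR (- (s * t ^+ 2 / 2)) * cos th) ->
  has_mean eta 0 /\ has_mean (fun x => eta x ^+ 2) s.
Proof.
move=> meta s0 H.
have m2 tau : has_mean (fun x => (eta x - tau) ^+ 2) (s + tau ^+ 2).
  apply: has_mean_ge0.
  - by apply: measurable_funX; exact: measurable_funB.
  - by move=> x; exact: sqr_ge0.
  - exact: gaussian_second_moment.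
have m20 : has_mean (fun x => eta x ^+ 2) s.
  have := m2 0; rewrite expr0n addr0.
  by rewrite (_ : (fun x => _) = fun x => eta x ^+ 2)//; apply/funext => x; rewrite subr0.
split=> //.
have := has_meanZ (2^-1) (has_meanD (has_meanD m20 (has_mean_cst 1)) (has_meanZ (-1) (m2 1))).
rewrite (_ : (fun x => _) = eta); last by apply/funext => x; field.
by rewrite (_ : 2^-1 * _ = 0)//; field.
Qed.

End has_mean.

Section gaussian_hilbert.
Context {R : realType} {H : completeNormedModType R} (ip : H -> H -> R).
Local Notation HB := (borel H).
Hypothesis ipP : inner_product ip.
Variables (mu : probability HB R) (m0 : H) (C : H -> H).
Hypothesis mu_gauss : is_gaussian ip mu m0 C.
Variables (n : nat) (A : 'I_n -> H).
Hypothesis covE : forall h, ip (C h) h = \sum_i (ip (A i) h) ^+ 2.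

Lemma measurable_ip (h : H) : measurable_fun setT ((fun x => ip (x - m0) h) : HB -> R).
Proof.
apply: continuous_borel_measurable => x.
apply: (@continuous_comp _ _ _ (fun x => x - m0) (ip^~ h)); last exact: continuous_ip.
by apply: cvgB; [exact: cvg_id|exact: cvg_cst].
Qed.

Lemma measurable_sqdist_mean :
  measurable_fun setT ((fun x => `|x - m0| ^+ 2) : HB -> R).
Proof.
apply: measurable_funX; apply: continuous_borel_measurable => x.
apply: (@continuous_comp _ _ _ (fun x : H => x - m0) (fun y : H => `|y|));
  last exact: norm_continuous.
by apply: cvgB; [exact: cvg_id|exact: cvg_cst].
Qed.

Lemma gaussian_cos (h : H) (th : R) :
  \int[mu]_x (cos (ip ((x : H) - m0) h + th)) =
  expR (- (\sum_i (ip (A i) h) ^+ 2) / 2) * cos th.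
Proof.
have [gc gs] := mu_gauss h.
have mi : measurable_fun setT ((fun x => ip x h) : HB -> R).
  by apply: continuous_borel_measurable; exact: continuous_ip.
have ic : mu.-integrable setT (EFin \o (fun x => cos (ip x h))).
  apply: (@bounded_integrable _ _ _ _ _ 1); last by move=> x; exact: norm_cos_le1.
  apply: measurableT_comp mi.
  by apply: continuous_measurable_fun; exact: continuous_cos.
have isn : mu.-integrable setT (EFin \o (fun x => sin (ip x h))).
  apply: (@bounded_integrable _ _ _ _ _ 1); last by move=> x; exact: norm_sin_le1.
  apply: measurableT_comp mi.
  by apply: continuous_measurable_fun; exact: continuous_sin.
have hc : has_mean mu (fun x => cos (ip x h)) (expR (- (ip (C h) h) / 2) * cos (ip m0 h)).
  by split=> //; rewrite /Rintegral gc.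
have hs : has_mean mu (fun x => sin (ip x h)) (expR (- (ip (C h) h) / 2) * sin (ip m0 h)).
  by split=> //; rewrite /Rintegral gs.
pose th' := th - ip m0 h.
have [_ hE] := has_meanD (has_meanZ (cos th') hc) (has_meanZ (- sin th') hs).
transitivity (\int[mu]_x (cos th' * cos (ip x h) + - sin th' * sin (ip x h))).
  apply: eq_Rintegral => x _; rewrite (ipBl ipP).
  rewrite (_ : ip x h - ip m0 h + th = ip x h + th'); last by rewrite /th'; ring.
  by rewrite cosD; ring.
rewrite hE -covE (_ : th = ip m0 h + th'); last by rewrite /th'; ring.
by rewrite cosD; ring.
Qed.

Lemma gaussian_ip_mean (h : H) :
  has_mean mu (fun x => ip ((x : H) - m0) h) 0 /\
  has_mean mu (fun x => ip ((x : H) - m0) h ^+ 2) (\sum_i (ip (A i) h) ^+ 2).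
Proof.
apply: gaussian_has_mean.
- exact: measurable_ip.
- by apply: sumr_ge0 => i _; exact: sqr_ge0.
- move=> t th; under eq_Rintegral do rewrite -(ipZr ipP).
  rewrite gaussian_cos; congr (expR _ * _); rewrite mulNr; congr (- (_ / 2)).
  by rewrite big_distrl/=; apply: eq_bigr => i _; rewrite (ipZr ipP) exprMn mulrC.
Qed.

Lemma gram_basis : exists (U : 'M[R]_n) (e : 'I_n -> H) (lam : 'I_n -> R),
  [/\ forall k l, ip (e k) (e l) = lam k *+ (k == l),
      forall i, A i = \sum_k U i k *: e k,
      forall k, e k = \sum_i U i k *: A i
    & forall k l, \sum_i U i k * U i l = (k == l)%:R].
Proof.
pose G := \matrix_(i, j) ip (A i) (A j).
have [U [d [UU GE]]] : exists (U : 'M[R]_n) (d : 'rV[R]_n),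
    U *m U^T = 1%:M /\ G = U *m diag_mx d *m U^T.
  by apply: spectral_symmetric; apply/matrixP => i j; rewrite !mxE (ipC ipP).
have UU' := mulmx1C UU.
pose e k := \sum_i U i k *: A i.
exists U, e, (fun k => d 0 k); split=> //.
- move=> k l; have : U^T *m G *m U = diag_mx d.
    by rewrite GE !mulmxA UU' mul1mx -mulmxA UU' mulmx1.
  move=> /matrixP/(_ k l); rewrite !mxE => <-.
  rewrite (ip_sumr ipP); apply: eq_bigr => j _.
  rewrite (ipZr ipP) mulrC mxE (ip_suml ipP); congr (_ * _); apply: eq_bigr => i _.
  by rewrite (ipZl ipP) !mxE.
- move=> i; rewrite /e.
  under eq_bigr do rewrite scaler_sumr.
  rewrite exchange_big/= (bigD1 i)//= [X in _ + X]big1 ?addr0 => [|j ji].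
    under eq_bigr do rewrite scalerA.
    rewrite -scaler_suml; have /matrixP/(_ i i) := UU; rewrite !mxE eqxx.
    by under eq_bigr do rewrite mxE; move=> ->; rewrite scale1r.
  under eq_bigr do rewrite scalerA.
  rewrite -scaler_suml; have /matrixP/(_ i j) := UU; rewrite !mxE eq_sym (negbTE ji).
  by under eq_bigr do rewrite mxE; move=> ->; rewrite scale0r.
- move=> k l; have /matrixP/(_ k l) := UU'; rewrite !mxE => <-.
  by apply: eq_bigr => i _; rewrite mxE.
Qed.

Variable s : nat -> H.
Hypothesis s_dense : forall (v : H) (e : R), 0 < e -> exists n, `|v - s n| < e.

(* The components of [x - m0] orthogonal to the span of [A] have zero variance,
   hence vanish almost surely. *)
Lemma gaussian_support : exists E0 : set HB,
  [/\ measurable E0, mu E0 = 1%E,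
      forall x, E0 x -> exists a : 'I_n -> R, (x : H) - m0 = \sum_i a i *: A i
    & has_mean mu (fun x => `|(x : H) - m0| ^+ 2) (\sum_i ip (A i) (A i))].
Proof.
have [U [e [lam [ee AE eE Uorth]]]] := gram_basis.
pose proj v := \sum_k (ip v (e k) / lam k) *: e k.
have e0 k : lam k = 0 -> e k = 0.
  move=> l0; apply/eqP; rewrite -normr_eq0 -sqrf_eq0 -(ip_norm ipP) ee eqxx.
  by rewrite l0 mul0rn.
have ip_proj v w : ip (proj v) w = \sum_k ip v (e k) * ip w (e k) / lam k.
  rewrite (ip_suml ipP); apply: eq_bigr => k _.
  by rewrite (ipZl ipP) (ipC ipP (e k)) mulrAC.
have ip_proj_sym v w : ip v (proj w) = ip (proj v) w.
  by rewrite (ipC ipP) !ip_proj; apply: eq_bigr => k _; rewrite (mulrC (ip w _)).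
have ipe_proj l v : ip (e l) (v - proj v) = 0.
  rewrite (ipBr ipP) ip_proj_sym ip_proj (bigD1 l)//= [X in _ - (_ + X)]big1.
    rewrite ee eqxx mulr1n addr0 (ipC ipP v).
    have [l0|l0] := eqVneq (lam l) 0; first by rewrite e0// (ip0l ipP) mulr0 mul0r subr0.
    by rewrite mulrAC mulfV// mul1r subrr.
  by move=> k kl; rewrite ee eq_sym (negbTE kl) mulr0n !mul0r.
have ipA_proj i v : ip (A i) (v - proj v) = 0.
  by rewrite AE (ip_suml ipP) big1// => k _; rewrite (ipZl ipP) ipe_proj mulr0.
pose h m := s m - proj (s m).
pose E0 := [set x : HB | forall m, ip ((x : H) - m0) (h m) = 0].
have mE0 : measurable E0.
  rewrite (_ : E0 = \bigcap_m ((fun x : HB => ip ((x : H) - m0) (h m)) @^-1` [set 0])).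
    apply: bigcapT_measurable => m; rewrite -[X in measurable X]setTI.
    by apply: measurable_ip => //; exact: measurable_set1.
  by apply/seteqP; split => [x E0x m _|x E0x m]; [exact: E0x|exact: E0x].
have E0ae : {ae mu, forall x, E0 x}.
  apply/ae_foralln => m.
  have [_ [i2 v2]] := gaussian_ip_mean (h m).
  rewrite big1 in v2; last by move=> i _; rewrite ipA_proj expr0n.
  have m2 := measurable_int _ i2.
  have : (\int[mu]_x `|(ip ((x : H) - m0) (h m) ^+ 2)%:E| = 0)%E.
    under eq_integral do rewrite /= ger0_norm ?sqr_ge0//.
    by rewrite EFin_Rintegral// v2.
  move=> /(ae_eq_integral_abs _ measurableT m2); apply: filterS => x /(_ I) /= [] /eqP.
  by rewrite sqrf_eq0 => /eqP.
have muE0 : mu E0 = 1%E.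
  have : mu (~` E0) = 0%E by exact: (measure_negligible (measurableC mE0) E0ae).
  rewrite probability_setC// => /eqP; rewrite sube_eq ?fin_num_measure//.
  by rewrite add0e => /eqP <-.
have projE x : E0 x -> (x : H) - m0 = proj ((x : H) - m0).
  move=> E0x; apply/eqP; rewrite -subr_eq0; apply/eqP.
  apply: (dense_orthogonal s_dense ipP) => m.
  have := E0x m; rewrite /h; move: ((x : H) - m0) => w; rewrite (ipBr ipP) (ipBl ipP) ip_proj_sym.
  by [].
have sqE x : E0 x -> `|(x : H) - m0| ^+ 2 = \sum_k (lam k)^-1 * ip ((x : H) - m0) (e k) ^+ 2.
  move=> E0x; rewrite -(ip_norm ipP) {1}(projE _ E0x) ip_proj.
  by apply: eq_bigr => k _; rewrite mulrC expr2.
exists E0; split=> //.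
  move=> x /projE ->; exists (fun i => \sum_k (ip ((x : H) - m0) (e k) / lam k) * U i k).
  rewrite {1}/proj; under [RHS]eq_bigr do rewrite scaler_suml.
  rewrite exchange_big/=; apply: eq_bigr => k _.
  by rewrite {2}eE scaler_sumr; apply: eq_bigr => i _; rewrite scalerA.
have ipAe i k : ip (A i) (e k) = U i k * lam k.
  rewrite AE (ip_suml ipP) (bigD1 k)//= big1 ?addr0 => [|l lk].
    by rewrite (ipZl ipP) ee eqxx.
  by rewrite (ipZl ipP) ee (negbTE lk) mulr0.
have -> : \sum_i ip (A i) (A i) = \sum_k (lam k)^-1 * \sum_i ip (A i) (e k) ^+ 2.
  transitivity (\sum_k lam k).
    transitivity (\sum_i \sum_k U i k * U i k * lam k).
      apply: eq_bigr => i _; rewrite [X in ip _ X]AE (ip_sumr ipP).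
      by apply: eq_bigr => k _; rewrite (ipZr ipP) ipAe mulrA.
    rewrite exchange_big/=; apply: eq_bigr => k _.
    by rewrite -mulr_suml Uorth eqxx mul1r.
  apply: eq_bigr => k _; under eq_bigr do rewrite ipAe exprMn expr2.
  rewrite -mulr_suml Uorth eqxx mul1r.
  have [->|l0] := eqVneq (lam k) 0; first by rewrite expr0n mulr0.
  by rewrite expr2 mulKf.
apply: has_mean_ae; first exact: measurable_sqdist_mean.
  by apply: filterS E0ae => x; exact: sqE.
by apply: has_mean_sum => k; apply: has_meanZ; exact: (gaussian_ip_mean (e k)).2.
Qed.

End gaussian_hilbert.

(** * The regularized cost between Gaussian measures *)

Lemma expR_half_ln {R : realType} (x : R) : 0 < x -> expR (ln x / 2) = Num.sqrt x.
Proof.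
move=> x0; rewrite -[in RHS](lnK (x := x)) ?posrE// [X in Num.sqrt (expR X)]splitr expRD -expr2.
by rewrite sqrtr_sqr ger0_norm// expR_ge0.
Qed.

Section coupling_density.
Context {R : realType} {H : completeNormedModType R} (ip : H -> H -> R).
Local Notation HB := (borel H).
Hypothesis ipP : inner_product ip.
Variables (mu : probability HB R) (m0 : H) (C : H -> H).
Hypothesis mu_gauss : is_gaussian ip mu m0 C.
Variables (n : nat) (A h : 'I_n -> H) (s : 'I_n -> R).
Hypotheses (covE : forall v, ip (C v) v = \sum_i (ip (A i) v) ^+ 2)
  (orthA : forall i l, \sum_j ip (A j) (h i) * ip (A j) (h l) = s i *+ (i == l)).
Variables (al kk : 'I_n -> R).
Hypotheses (al0 : forall i, 0 <= al i) (alkk : forall i, al i * (1 + al i) = kk i ^+ 2)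
  (als : forall i, al i * s i = al i).

Let s0 i : 0 <= s i.
Proof.
have := orthA i i; rewrite eqxx mulr1n => <-.
by apply: sumr_ge0 => j _; rewrite -expr2 sqr_ge0.
Qed.

Lemma gaussian_coords_cos (t : 'I_n -> R) th :
  \int[mu]_x (cos (\sum_i t i * ip ((x : H) - m0) (h i) + th)) =
  expR (- (\sum_i s i * t i ^+ 2) / 2) * cos th.
Proof.
transitivity (\int[mu]_x (cos (ip ((x : H) - m0) (\sum_i t i *: h i) + th))).
  apply: eq_Rintegral => x _; congr (cos (_ + _)).
  by rewrite (ip_sumr ipP); apply: eq_bigr => i _; rewrite (ipZr ipP).
rewrite (gaussian_cos ipP mu_gauss covE); congr (expR (- _ / 2) * _).
transitivity (\sum_j \sum_i \sum_l t i * t l * (ip (A j) (h i) * ip (A j) (h l))).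
  apply: eq_bigr => j _; rewrite (ip_sumr ipP) expr2 big_distrlr/=.
  by apply: eq_bigr => i _; apply: eq_bigr => l _; rewrite !(ipZr ipP); ring.
rewrite exchange_big/=; apply: eq_bigr => i _.
rewrite exchange_big/=; under eq_bigr do rewrite -mulr_sumr orthA.
rewrite (bigD1 i)//= eqxx big1 ?addr0; first by rewrite mulr1n; ring.
by move=> l li; rewrite eq_sym (negbTE li) mulr0n mulr0.
Qed.

Lemma gaussian_coords_prod (tau : 'I_n -> R) :
  has_mean mu (fun x => \prod_i expR (- (al i * (ip ((x : H) - m0) (h i) - tau i) ^+ 2 / 2)))
    (\prod_i ((Num.sqrt (1 + al i))^-1 * expR (- (al i * tau i ^+ 2 / (2 * (1 + al i)))))).
Proof.
have mip i := measurable_ip ipP m0 (h i).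
split.
  apply: (@bounded_integrable _ _ _ _ _ 1).
    apply: measurable_prod => i _.
    apply: (@measurableT_comp _ _ _ _ _ _ (gauss_bell (al i)) _
      (fun x : HB => ip ((x : H) - m0) (h i) - tau i)).
      exact: measurable_gauss_bell.
    exact: measurable_funB.
  move=> x; rewrite normr_prod.
  suff /andP[] : 0 <= \prod_i `|expR (- (al i * (ip ((x : H) - m0) (h i) - tau i) ^+ 2 / 2))| <= 1 by [].
  apply: (big_ind (fun u : R => 0 <= u <= 1)); first by rewrite ler01 lexx.
    by move=> u v /andP[u0 u1] /andP[v0 v1]; rewrite mulr_ge0//= mulr_ile1.
  move=> j _; rewrite normr_ge0 ger0_norm ?expR_ge0//= -[leRHS]expR0 ler_expR oppr_le0.
  by rewrite divr_ge0// mulr_ge0// sqr_ge0.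
rewrite (Rintegral_gaussian_prod (s := s))//; last exact: gaussian_coords_cos.
by apply: eq_bigr => i _; rewrite als.
Qed.

(* The logarithm of the density of the optimal plan with respect to the product
   measure; [al (1 + al) = kk ^ 2] is what makes both marginals correct. *)
Definition log_density (u v : 'I_n -> R) : R :=
  \sum_i (ln (1 + al i) / 2 - al i / 2 * u i ^+ 2 - al i / 2 * v i ^+ 2 + kk i * u i * v i).

Lemma log_density_sym u v : log_density u v = log_density v u.
Proof. by apply: eq_bigr => i _; ring. Qed.

(* Completing the square in the second argument. *)
Lemma density_marginal (u : 'I_n -> R) :
  (\int[mu]_x (expR (log_density u (fun i => ip ((x : H) - m0) (h i))))%:E = 1)%E.
Proof.
have kk0 i : al i = 0 -> kk i = 0.
  by move=> a0; have := alkk i; rewrite a0 mul0r => /esym/eqP; rewrite sqrf_eq0 => /eqP.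
pose tau i := kk i * u i / al i.
pose c i := ln (1 + al i) / 2 + (al i * tau i ^+ 2 / 2 - al i / 2 * u i ^+ 2).
have LE v : expR (log_density u v) =
    expR (\sum_i c i) * \prod_i expR (- (al i * (v i - tau i) ^+ 2 / 2)).
  rewrite -expR_sum -expRD; congr expR; rewrite -big_split/=; apply: eq_bigr => i _.
  rewrite /c /tau; have [a0|a0] := eqVneq (al i) 0; first by rewrite a0 (kk0 _ a0); ring.
  by field.
have [iM M] := has_meanZ (expR (\sum_i c i)) (gaussian_coords_prod tau).
under eq_integral do rewrite LE.
rewrite EFin_Rintegral// M; congr EFin.
rewrite expR_sum -big_split/= big1// => i _.
have a1 : 0 < 1 + al i by rewrite ltr_pwDl.
have sq0 : Num.sqrt (1 + al i) != 0 by rewrite gt_eqF// sqrtr_gt0.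
rewrite /c expRD expR_half_ln// mulrACA divff// mul1r -expRD -[RHS]expR0; congr expR.
rewrite /tau; have [a0|a0] := eqVneq (al i) 0; first by rewrite a0; ring.
have := alkk i; set k := kk i => kE.
transitivity (k ^+ 2 * u i ^+ 2 / (2 * (1 + al i)) - al i / 2 * u i ^+ 2).
  by field; rewrite a0 gt_eqF.
by rewrite -kE; field; rewrite gt_eqF.
Qed.

End coupling_density.

Section gaussian_OTeps.
Context {R : realType} {H : completeNormedModType R} (ip : H -> H -> R).
Local Notation HB := (borel H).
Hypothesis ipP : inner_product ip.
Variables (mu nu : probability HB R) (m0 m1 : H) (C D : H -> H).
Hypotheses (mu_gauss : is_gaussian ip mu m0 C) (nu_gauss : is_gaussian ip nu m1 D).
Variables (n : nat) (A B h k : 'I_n -> H) (sig : 'I_n -> R).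
Let s i : R := (sig i != 0)%:R.
Hypotheses (covA : forall v, ip (C v) v = \sum_i (ip (A i) v) ^+ 2)
  (covB : forall v, ip (D v) v = \sum_i (ip (B i) v) ^+ 2)
  (orthA : forall i l, \sum_j ip (A j) (h i) * ip (A j) (h l) = s i *+ (i == l))
  (orthB : forall i l, \sum_j ip (B j) (k i) * ip (B j) (k l) = s i *+ (i == l))
  (pairAB : forall a b : 'I_n -> R,
    ip (\sum_i a i *: A i) (\sum_i b i *: B i) =
    \sum_i sig i * ip (\sum_i a i *: A i) (h i) * ip (\sum_i b i *: B i) (k i)).
Variable d : nat -> H.
Hypothesis d_dense : forall (v : H) (e : R), 0 < e -> exists n, `|v - d n| < e.

Lemma gaussian_OTeps (eps : R) : 0 < eps ->
  let r i := Num.sqrt (1 + 16 / eps ^+ 2 * sig i ^+ 2) in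
  OTeps eps mu nu = (`|m0 - m1| ^+ 2 + \sum_i ip (A i) (A i) + \sum_i ip (B i) (B i)
    - eps / 2 * \sum_i (r i - 1) + eps / 2 * \sum_i ln (2^-1 + 2^-1 * r i))%:E.
Proof.
move=> eps0 r.
pose al i := (r i - 1) / 2; pose kk i := 2 / eps * sig i.
have eps20 : 0 <= 16 / eps ^+ 2 by rewrite divr_ge0// sqr_ge0.
have r1 i : 1 <= r i.
  by rewrite -[leLHS]sqrtr1 ler_wsqrtr// lerDl mulr_ge0// sqr_ge0.
have al0 i : 0 <= al i by rewrite divr_ge0// subr_ge0.
have alkk i : al i * (1 + al i) = kk i ^+ 2.
  have : r i ^+ 2 = 1 + 16 / eps ^+ 2 * sig i ^+ 2.
    by rewrite sqr_sqrtr// addr_ge0// mulr_ge0// sqr_ge0.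
  rewrite /al /kk => rE; transitivity ((r i ^+ 2 - 1) / 4); first by field.
  by rewrite rE; field; rewrite gt_eqF.
have als i : al i * s i = al i.
  rewrite /s; case: eqP => [s0|_]; last by rewrite mulr1.
  by rewrite mulr0 /al /r s0 expr0n/= mulr0 addr0 sqrtr1 subrr mul0r.
have [E0 [mE0 muE0 E0s [isqA vsqA]]] := gaussian_support ipP mu_gauss covA d_dense.
have [E1 [mE1 nuE1 E1s [isqB vsqB]]] := gaussian_support ipP nu_gauss covB d_dense.
pose xi (x : HB) i := ip ((x : H) - m0) (h i).
pose eta (y : HB) i := ip ((y : H) - m1) (k i).
pose p (z : HB * HB) := expR (log_density al kk (xi z.1) (eta z.2)).
pose cst0 := `|m0 - m1| ^+ 2 + eps / 2 * \sum_i ln (1 + al i).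
pose phi (x : HB) := `|(x : H) - m0| ^+ 2 + 2 * ip ((x : H) - m0) (m0 - m1)
  + - (eps / 2) * (\sum_i al i * xi x i ^+ 2) + cst0.
pose psi (y : HB) := `|(y : H) - m1| ^+ 2 + -2 * ip ((y : H) - m1) (m0 - m1)
  + - (eps / 2) * (\sum_i al i * eta y i ^+ 2).
have hphi : has_mean mu phi (\sum_i ip (A i) (A i) + 2 * 0
    + - (eps / 2) * (\sum_i al i * s i) + cst0).
  apply: has_meanD; last exact: has_mean_cst.
  apply: has_meanD.
    apply: has_meanD => //; apply: has_meanZ.
    exact: (gaussian_ip_mean ipP mu_gauss covA _).1.
  apply: has_meanZ; apply: has_mean_sum => i; apply: has_meanZ.
  have := (gaussian_ip_mean ipP mu_gauss covA (h i)).2.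
  by under eq_bigr do rewrite expr2; rewrite orthA eqxx.
have hpsi : has_mean nu psi (\sum_i ip (B i) (B i) + -2 * 0
    + - (eps / 2) * (\sum_i al i * s i)).
  apply: has_meanD.
    apply: has_meanD => //; apply: has_meanZ.
    exact: (gaussian_ip_mean ipP nu_gauss covB _).1.
  apply: has_meanZ; apply: has_mean_sum => i; apply: has_meanZ.
  have := (gaussian_ip_mean ipP nu_gauss covB (k i)).2.
  by under eq_bigr do rewrite expr2; rewrite orthB eqxx.
have mxi i : measurable_fun setT (fun z : HB * HB => xi z.1 i).
  exact: (measurableT_comp (measurable_ip ipP m0 (h i)) measurable_fst).
have meta i : measurable_fun setT (fun z : HB * HB => eta z.2 i).
  exact: (measurableT_comp (measurable_ip ipP m1 (k i)) measurable_snd).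
have mp : measurable_fun setT p.
  apply: measurableT_comp => //; apply: measurable_sum => i.
  apply: measurable_funD.
    apply: measurable_funB; first apply: measurable_funB => //.
      by apply: measurable_funM => //; exact: measurable_funX.
    by apply: measurable_funM => //; exact: measurable_funX.
  by apply: measurable_funM => //; exact: measurable_funM.
have mcost : measurable_fun setT (fun z : HB * HB => `|(z.1 : H) - (z.2 : H)| ^+ 2).
  by apply: measurable_funX; exact: (measurable_dist d_dense).
have sqint (P : probability HB R) (m : H) :
    P.-integrable setT (EFin \o (fun x : HB => `|(x : H) - m| ^+ 2)) ->
    P.-integrable setT (fun x : HB => (`|x : H| ^+ 2)%:E).
  move=> iP.
  apply: (@le_integrable _ _ _ P _ measurableT _
    (fun x : HB => 2%:E * (`|(x : H) - m| ^+ 2)%:E + (2 * `|m| ^+ 2)%:E)%E).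
  - apply/measurable_EFinP.
    have : measurable_fun setT ((fun x => `|x| ^+ 2) : HB -> R).
      apply: measurable_funX; apply: continuous_borel_measurable.
      exact: norm_continuous.
    exact.
  - move=> x _ /=; rewrite lee_fin ger0_norm ?sqr_ge0//.
    rewrite ger0_norm ?addr_ge0 ?mulr_ge0 ?sqr_ge0//.
    have h1 := ler_normD ((x : H) - m) m; rewrite subrK in h1.
    apply: (@le_trans _ _ ((`|(x : H) - m| + `|m|) ^+ 2)).
      by rewrite ler_sqr ?nnegrE ?addr_ge0.
    have := sqr_ge0 (`|(x : H) - m| - `|m|); nra.
  - apply: integrableD => //; first exact: integrableZl.
    exact: finite_measure_integrable_cst.
have key x y : E0 x -> E1 y -> eps * ln (p (x, y)) + `|(x : H) - (y : H)| ^+ 2 = phi x + psi y.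
  move=> /E0s[a xa] /E1s[b yb].
  have pairE : ip ((x : H) - m0) ((y : H) - m1) = \sum_i sig i * xi x i * eta y i.
    by rewrite /xi /eta xa yb pairAB.
  have -> : `|(x : H) - (y : H)| ^+ 2 = `|m0 - m1| ^+ 2 + `|(x : H) - m0| ^+ 2
      + `|(y : H) - m1| ^+ 2 + 2 * ip ((x : H) - m0) (m0 - m1)
      - 2 * ip ((y : H) - m1) (m0 - m1) - 2 * ip ((x : H) - m0) ((y : H) - m1).
    have -> : (x : H) - (y : H) = (m0 - m1) + ((x : H) - m0) - ((y : H) - m1).
      have -> : (m0 - m1) + ((x : H) - m0) = (x : H) - m1 by rewrite addrC addrA subrK.
      by rewrite opprB addrA subrK.
    rewrite -!(ip_norm ipP); move: (m0 - m1) ((x : H) - m0) ((y : H) - m1) => u v w.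
    rewrite (ipBl ipP) !(ipBr ipP) !(ipDl ipP) !(ipDr ipP).
    by rewrite (ipC ipP u v) (ipC ipP u w) (ipC ipP v w); ring.
  rewrite pairE /p expRK.
  have -> : eps * log_density al kk (xi x) (eta y) = eps / 2 * (\sum_i ln (1 + al i))
      + - (eps / 2) * (\sum_i al i * xi x i ^+ 2)
      + - (eps / 2) * (\sum_i al i * eta y i ^+ 2) + 2 * (\sum_i sig i * xi x i * eta y i).
    rewrite !mulr_sumr -!big_split/=; apply: eq_bigr => i _; rewrite /kk; field.
    by rewrite gt_eqF.
  by rewrite /phi /psi /cst0; ring.
have p1 x : (\int[nu]_y (p (x, y))%:E = 1)%E.
  exact: (density_marginal ipP nu_gauss covB orthB al0 alkk als (xi x)).
have p2 y : (\int[mu]_x (p (x, y))%:E = 1)%E.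
  rewrite -[RHS](density_marginal ipP mu_gauss covA orthA al0 alkk als (eta y)).
  by apply: eq_integral => x _; rewrite /p /= log_density_sym.
have [iphi vphi] := hphi; have [ipsi vpsi] := hpsi.
rewrite (@OTeps_dual _ _ mu nu eps p phi psi E0 E1)//; last 3 first.
- by move=> z; exact: expR_gt0.
- exact: sqint isqA.
- exact: sqint isqB.
congr EFin; rewrite vphi vpsi /cst0.
rewrite (eq_bigr al (fun i _ => als i)).
have -> : \sum_i (r i - 1) = 2 * \sum_i al i.
  by rewrite mulr_sumr; apply: eq_bigr => i _; rewrite /al; field.
have -> : \sum_i ln (2^-1 + 2^-1 * r i) = \sum_i ln (1 + al i).
  by apply: eq_bigr => i _; congr ln; rewrite /al; field.
by field.
Qed.

End gaussian_OTeps.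

(** * Singular values and empirical covariances *)

Section svd.
Context {R : realType} {H : normedModType R} (ip : H -> H -> R).
Hypothesis ipP : inner_product ip.
Variables (n : nat) (A B : 'I_n -> H) (U : 'M[R]_n) (d : 'rV[R]_n).
Let M : 'M[R]_n := \matrix_(i, j) ip (A i) (B j).
Hypotheses (UU : U *m U^T = 1%:M) (ME : M *m M^T = U *m diag_mx d *m U^T)
  (d0 : forall i, 0 <= d 0 i).

Let V := M^T *m U.
Let sig i := Num.sqrt (d 0 i).
Let s i : R := (sig i != 0)%:R.
Let h i := \sum_l ((d 0 i)^-1 * V l i) *: B l.
Let k i := \sum_j ((sig i)^-1 * U j i) *: A j.

Let UU' : U^T *m U = 1%:M. Proof. exact: mulmx1C. Qed.

Let sig2 i : sig i ^+ 2 = d 0 i. Proof. exact: sqr_sqrtr. Qed.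

Let sE i : s i = (d 0 i != 0)%:R.
Proof. by rewrite /s -sig2 sqrf_eq0. Qed.

Let colsU i l : \sum_j U j i * U j l = (i == l)%:R.
Proof.
by have /matrixP/(_ i l) := UU'; rewrite !mxE => <-; apply: eq_bigr => j _; rewrite mxE.
Qed.

Let colsV i l : \sum_j V j i * V j l = d 0 i *+ (i == l).
Proof.
have : V^T *m V = diag_mx d.
  by rewrite /V trmx_mul trmxK !mulmxA -(mulmxA U^T) ME !mulmxA UU' mul1mx -mulmxA UU' mulmx1.
move=> /matrixP/(_ i l); rewrite [RHS]mxE [LHS]mxE => <-.
by apply: eq_bigr => j _; rewrite [V^T _ _]mxE.
Qed.

Let MV j i : \sum_l M j l * V l i = U j i * d 0 i.
Proof.
have : M *m V = U *m diag_mx d by rewrite /V mulmxA ME -mulmxA UU' mulmx1.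
by move=> /matrixP/(_ j i); rewrite [LHS]mxE => ->; rewrite mul_mx_diag mxE.
Qed.

Let UM l i : \sum_j U j i * M j l = V l i.
Proof. by rewrite /V [RHS]mxE; apply: eq_bigr => j _; rewrite mulrC [M^T _ _]mxE. Qed.

Let UV j l : \sum_i U j i * V l i = M j l.
Proof.
have : U *m V^T = M by rewrite /V trmx_mul trmxK mulmxA UU mul1mx.
move=> /matrixP/(_ j l); rewrite [LHS]mxE => <-.
by apply: eq_bigr => i _; rewrite [V^T _ _]mxE.
Qed.

Let V0 i l : d 0 i = 0 -> V l i = 0.
Proof.
move=> di; have := colsV i i; rewrite eqxx di mulr1n => /eqP.
rewrite psumr_eq0 => [/allP/(_ l)|j _]; last by rewrite -expr2 sqr_ge0.
by rewrite mem_index_enum => /(_ isT); rewrite mulf_eq0 orbb => /eqP.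
Qed.

Let ipAh j i : ip (A j) (h i) = U j i * s i.
Proof.
rewrite (ip_sumr ipP).
transitivity ((d 0 i)^-1 * \sum_l M j l * V l i).
  by rewrite mulr_sumr; apply: eq_bigr => l _; rewrite (ipZr ipP) [M _ _]mxE; ring.
rewrite MV sE; have [->|di] := eqVneq (d 0 i) 0; first by rewrite !mulr0.
by rewrite mulrCA mulVf.
Qed.

Let ipBk l i : ip (B l) (k i) = (sig i)^-1 * V l i.
Proof.
rewrite (ip_sumr ipP) -UM mulr_sumr; apply: eq_bigr => j _.
by rewrite (ipZr ipP) [M _ _]mxE (ipC ipP (A j)); ring.
Qed.

Lemma svd_pairing : exists h k : 'I_n -> H,
  [/\ forall i l, \sum_j ip (A j) (h i) * ip (A j) (h l) =
        (Num.sqrt (d 0 i) != 0)%:R *+ (i == l),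
      forall i l, \sum_j ip (B j) (k i) * ip (B j) (k l) =
        (Num.sqrt (d 0 i) != 0)%:R *+ (i == l)
    & forall a b : 'I_n -> R,
      ip (\sum_i a i *: A i) (\sum_i b i *: B i) =
      \sum_i Num.sqrt (d 0 i) * ip (\sum_i a i *: A i) (h i) * ip (\sum_i b i *: B i) (k i)].
Proof.
exists h, k; split.
- move=> i l; transitivity (s i * s l * \sum_j U j i * U j l).
    by rewrite mulr_sumr; apply: eq_bigr => j _; rewrite !ipAh; ring.
  rewrite colsU; have [<-|il] := eqVneq i l; last by rewrite mulr0.
  by rewrite mulr1 mulr1n /s; case: (sig i != 0); rewrite ?mulr1 ?mulr0.
- move=> i l; transitivity ((sig i)^-1 * (sig l)^-1 * \sum_j V j i * V j l).
    by rewrite mulr_sumr; apply: eq_bigr => j _; rewrite !ipBk; ring.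
  rewrite colsV; have [<-|il] := eqVneq i l; last by rewrite !mulr0n mulr0.
  rewrite !mulr1n -[X in _ * X]sig2 -/(sig i).
  have [->|si] := eqVneq (sig i) 0; first by rewrite expr0n mulr0.
  by rewrite expr2 mulrACA mulVf// mulr1.
- move=> a b.
  transitivity (\sum_i (\sum_j a j * U j i) * (\sum_l b l * V l i)); last first.
    apply: eq_bigr => i _; rewrite !(ip_suml ipP).
    have -> : \sum_j ip (a j *: A j) (h i) = (\sum_j a j * U j i) * s i.
      by rewrite mulr_suml; apply: eq_bigr => j _; rewrite (ipZl ipP) ipAh mulrA.
    have -> : \sum_j ip (b j *: B j) (k i) = (\sum_l b l * V l i) * (sig i)^-1.
      by rewrite mulr_suml; apply: eq_bigr => j _; rewrite (ipZl ipP) ipBk; ring.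
    rewrite -/(sig i) /s; have [si|si] := eqVneq (sig i) 0; last by rewrite mulr1; field.
    have di : d 0 i = 0 by rewrite -sig2 si expr0n.
    have -> : \sum_l b l * V l i = 0 by rewrite big1// => l _; rewrite V0// mulr0.
    by rewrite mul0r !mulr0.
  rewrite (ip_suml ipP).
  transitivity (\sum_j \sum_l \sum_i a j * b l * (U j i * V l i)).
    apply: eq_bigr => j _; rewrite (ip_sumr ipP); apply: eq_bigr => l _.
    by rewrite -mulr_sumr UV [M _ _]mxE (ipZl ipP) (ipZr ipP) mulrA.
  under eq_bigr do rewrite exchange_big/=.
  rewrite exchange_big/=; apply: eq_bigr => i _.
  rewrite big_distrlr/=; apply: eq_bigr => j _; apply: eq_bigr => l _.
  by ring.
Qed.

End svd.

Section centering_theory.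
Context {R : realType} (m : nat).
Hypothesis m_gt0 : (0 < m)%N.
Local Notation J := (@centering R m).

Let m_neq0 : m%:R != 0 :> R. Proof. by rewrite pnatr_eq0 -lt0n. Qed.

Lemma centeringE i j : J i j = (i == j)%:R - m%:R^-1.
Proof. by rewrite !mxE big_ord1 !mxE !mulr1. Qed.

Lemma centering_tr : J^T = J.
Proof. by apply/matrixP => i j; rewrite mxE !centeringE eq_sym. Qed.

Lemma centering_idem : J *m J = J.
Proof.
apply/matrixP => i j; rewrite mxE centeringE.
transitivity (\sum_(l < m) ((i == l)%:R * (l == j)%:R - (i == l)%:R * m%:R^-1
    - (l == j)%:R * m%:R^-1 + m%:R^-2 : R)).
  by apply: eq_bigr => l _; rewrite !centeringE; field.
rewrite !big_split/= !sumrN sumr_const card_ord.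
rewrite (bigD1 i)//= eqxx mul1r big1 ?addr0 => [|l li]; last first.
  by rewrite eq_sym (negbTE li) mul0r.
rewrite (bigD1 i)//= eqxx mul1r big1 ?addr0 => [|l li]; last first.
  by rewrite eq_sym (negbTE li) mul0r.
rewrite (bigD1 j)//= eqxx mul1r big1 ?addr0 => [|l lj]; last first.
  by rewrite (negbTE lj) mul0r.
by rewrite -mulr_natr; field.
Qed.

End centering_theory.

Lemma ones_formE {R : realType} m (A : 'M[R]_m) : ones_form A = \sum_i \sum_j A i j.
Proof.
rewrite /ones_form mxE exchange_big/=; apply: eq_bigr => j _.
rewrite !mxE mulr1; apply: eq_bigr => i _; by rewrite !mxE mul1r.
Qed.

Section empirical.
Context {R : realType} {X : Type} (K : X -> X -> R).
Context {H : completeNormedModType R} (ip : H -> H -> R) (Phi : X -> H).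
Hypothesis HK : rkhs_feature_map K ip Phi.
Variable m : nat.
Hypothesis m_gt0 : (0 < m)%N.
Local Notation J := (@centering R m).
Implicit Types x y : 'I_m -> X.

Let ipP : inner_product ip. Proof. by case: HK. Qed.

Let ipPhi u v : ip (Phi u) (Phi v) = K u v. Proof. by case: HK. Qed.

Let m_neq0 : m%:R != 0 :> R. Proof. by rewrite pnatr_eq0 -lt0n. Qed.

Let sqrtm2 : (Num.sqrt m%:R)^-1 * (Num.sqrt m%:R)^-1 = m%:R^-1 :> R.
Proof. by rewrite -invfM -expr2 sqr_sqrtr. Qed.

(* The columns of the square root [Phi(X) J_m / sqrt m] of the covariance. *)
Definition centered_feature x (j : 'I_m) : H :=
  (Num.sqrt m%:R)^-1 *: \sum_k J j k *: Phi (x k).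

Lemma ip_centered_feature x j h :
  ip (centered_feature x j) h = (Num.sqrt m%:R)^-1 * \sum_k J j k * ip (Phi (x k)) h.
Proof.
rewrite (ipZl ipP) (ip_suml ipP); congr (_ * _).
by apply: eq_bigr => k _; rewrite (ipZl ipP).
Qed.

Lemma ip_emp_cov x h :
  ip (emp_cov ip Phi x h) h = \sum_j ip (centered_feature x j) h ^+ 2.
Proof.
pose f : 'cV[R]_m := \col_k ip (Phi (x k)) h.
have JfE j : (J *m f) j 0 = \sum_k J j k * ip (Phi (x k)) h.
  by rewrite mxE; apply: eq_bigr => k _; rewrite [f _ _]mxE.
rewrite /emp_cov (ipZl ipP) (ip_suml ipP).
transitivity (m%:R^-1 * (f^T *m (J *m f)) 0 0).
  congr (_ * _); rewrite mxE; apply: eq_bigr => j _.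
  by rewrite (ipZl ipP) JfE !mxE mulrC.
rewrite -{1}(@centering_idem R m m_gt0) -{1}(@centering_tr R m) !mulmxA -trmx_mul -mulmxA.
rewrite mxE mulr_sumr; apply: eq_bigr => j _.
by rewrite ip_centered_feature -JfE exprMn expr2 sqrtm2 [(J *m f)^T _ _]mxE.
Qed.

Lemma centered_feature_gram x y :
  \matrix_(i, j) ip (centered_feature x i) (centered_feature y j) =
  m%:R^-1 *: (J *m gram K x y *m J).
Proof.
rewrite -[X in _ *m X]centering_tr; apply/matrixP => i j.
rewrite mxE [RHS]mxE ip_centered_feature [X in _ = _ * X]mxE -sqrtm2 -mulrA; congr (_ * _).
transitivity ((Num.sqrt m%:R)^-1 * \sum_k \sum_l J i k * K (x k) (y l) * J j l).
  rewrite mulr_sumr; apply: eq_bigr => k _.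
  rewrite (ipC ipP) ip_centered_feature mulrCA; congr (_ * _).
  rewrite mulr_sumr; apply: eq_bigr => l _.
  by rewrite (ipC ipP) ipPhi; ring.
congr (_ * _); rewrite exchange_big/=; apply: eq_bigr => l _.
rewrite [J^T _ _]mxE [(J *m gram K x y) i l]mxE mulr_suml; apply: eq_bigr => k _.
by rewrite [gram _ _ _ _ _]mxE.
Qed.

Lemma sum_centered_feature x :
  \sum_i ip (centered_feature x i) (centered_feature x i) =
  m%:R^-1 * \tr (gram K x x *m J).
Proof.
transitivity (\tr (\matrix_(i, j) ip (centered_feature x i) (centered_feature x j))).
  by apply: eq_bigr => i _; rewrite mxE.
rewrite centered_feature_gram mxtraceZ; congr (_ * _).
by rewrite mxtrace_mulC !mulmxA centering_idem// mxtrace_mulC.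
Qed.

Lemma emp_mean_dist x y : `|emp_mean Phi x - emp_mean Phi y| ^+ 2 =
  m%:R^-2 * ones_form (gram K x x + gram K y y - 2%:R *: gram K x y).
Proof.
have ipE (u v : 'I_m -> X) : ip (emp_mean Phi u) (emp_mean Phi v) =
    m%:R^-2 * \sum_i \sum_j K (u i) (v j).
  rewrite /emp_mean (ipZl ipP) (ipZr ipP) (ip_suml ipP) mulrA; congr (_ * _).
    by rewrite -invfM -expr2.
  apply: eq_bigr => i _; rewrite (ip_sumr ipP); apply: eq_bigr => j _.
  exact: ipPhi.
rewrite -(ip_norm ipP) (ipBl ipP) !(ipBr ipP) (ipC ipP (emp_mean Phi y) (emp_mean Phi x)).
rewrite !ipE ones_formE.
have -> : \sum_i \sum_j (gram K x x + gram K y y - 2%:R *: gram K x y) i j =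
    \sum_i \sum_j K (x i) (x j) + \sum_i \sum_j K (y i) (y j)
    - 2 * \sum_i \sum_j K (x i) (y j).
  rewrite mulr_sumr -sumrN -!big_split/=; apply: eq_bigr => i _.
  rewrite mulr_sumr -sumrN -!big_split/=; apply: eq_bigr => j _.
  by rewrite !mxE.
by ring.
Qed.

End empirical.

(** * Empirical measures and limits in the regularization *)

Lemma psdmx_gram {R : realType} m (N : 'M[R]_m) : psdmx (N *m N^T).
Proof.
move=> v; have -> : v^T *m (N *m N^T) *m v = (v^T *m N) *m (v^T *m N)^T.
  by rewrite trmx_mul trmxK !mulmxA.
exact: mx11_dot_ge0.
Qed.

Section empirical_OTeps.
Context {R : realType} (X : pseudoMetricType R) (K : X -> X -> R).
Context (H : completeNormedModType R) (ip : H -> H -> R) (Phi : X -> H).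
Hypotheses (sepX : separable_space X) (Kcont : continuous (fun p : X * X => K p.1 p.2))
  (HK : rkhs_feature_map K ip Phi).
Variable m : nat.
Hypothesis m_gt0 : (0 < m)%N.
Local Notation J := (@centering R m).

Let ipP : inner_product ip. Proof. by case: HK. Qed.

Lemma OTeps_empirical (x y : 'I_m -> X) (mu0 mu1 : probability (borel H) R)
    (U : 'M[R]_m) (d : 'rV[R]_m) (eps : R) :
  is_gaussian ip mu0 (emp_mean Phi x) (emp_cov ip Phi x) ->
  is_gaussian ip mu1 (emp_mean Phi y) (emp_cov ip Phi y) ->
  U *m U^T = 1%:M -> (forall i, 0 <= d 0 i) ->
  J *m gram K x y *m J *m (gram K x y)^T *m J = U *m diag_mx d *m U^T ->
  0 < eps ->
  let c := 16 / (eps ^+ 2 * m%:R ^+ 2) in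
  OTeps eps mu0 mu1 =
  (`|emp_mean Phi x - emp_mean Phi y| ^+ 2 + m%:R^-1 * \tr (gram K x x *m J)
   + m%:R^-1 * \tr (gram K y y *m J)
   - eps / 2 * (\sum_i (Num.sqrt (1 + c * d 0 i) - 1))
   + eps / 2 * (\sum_i ln (2^-1 + 2^-1 * Num.sqrt (1 + c * d 0 i))))%:E.
Proof.
move=> g0 g1 UU d0 PE eps0 c.
have m_neq0 : m%:R != 0 :> R by rewrite pnatr_eq0 -lt0n.
pose A := centered_feature Phi x; pose B := centered_feature Phi y.
pose d' : 'rV[R]_m := \row_i (m%:R^-2 * d 0 i).
have d'0 i : 0 <= d' 0 i by rewrite mxE mulr_ge0// invr_ge0 sqr_ge0.
pose M := \matrix_(i, j) ip (A i) (B j).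
have ME : M *m M^T = U *m diag_mx d' *m U^T.
  rewrite /M /A /B (centered_feature_gram HK).
  have -> : U *m diag_mx d' *m U^T = m%:R^-2 *: (U *m diag_mx d *m U^T).
    have -> : diag_mx d' = m%:R^-2 *: diag_mx d.
      by apply/matrixP => i j; rewrite !mxE mulrnAr.
    by rewrite -scalemxAr -scalemxAl.
  rewrite -PE linearZ/= -scalemxAl -scalemxAr scalerA -invfM -expr2.
  congr (_ *: _); rewrite !trmx_mul centering_tr !mulmxA.
  by rewrite -(mulmxA (J *m gram K x y) J J) centering_idem.
have [h [k [orthA orthB pairAB]]] := svd_pairing ipP UU ME d'0.
have [s s_dense] := rkhs_dense_seq sepX Kcont HK.
rewrite (gaussian_OTeps ipP g0 g1 (ip_emp_cov HK m_gt0 x) (ip_emp_cov HK m_gt0 y)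
  orthA orthB pairAB s_dense eps0).
rewrite !(sum_centered_feature HK m_gt0).
have cE i : 16 / eps ^+ 2 * Num.sqrt (d' 0 i) ^+ 2 = c * d 0 i.
  rewrite sqr_sqrtr// [d' _ _]mxE /c; field; by rewrite m_neq0 gt_eqF.
by congr (_ - _ * _ + _ * _)%:E; apply: eq_bigr => i _; rewrite cE.
Qed.

End empirical_OTeps.

Lemma continuous_sqrt_comp {R : realType} (f : R -> R) (x : R) :
  {for x, continuous f} -> {for x, continuous (fun u => Num.sqrt (f u))}.
Proof. by move=> cf; apply: continuous_comp => //; exact: sqrt_continuous. Qed.

Section entropic_term.
Context {R : realType} (A : R).
Hypothesis A0 : 0 <= A.

Definition entropic_term (eps : R) : R :=
  eps / 2 * (Num.sqrt (1 + A / eps ^+ 2) - 1)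
  - eps / 2 * ln (2^-1 + 2^-1 * Num.sqrt (1 + A / eps ^+ 2)).

Let r1 (eps : R) : 1 <= Num.sqrt (1 + A / eps ^+ 2).
Proof. by rewrite -[leLHS]sqrtr1 ler_wsqrtr// lerDl divr_ge0// sqr_ge0. Qed.

Lemma cvg_entropic_term_pinfty : entropic_term eps @[eps --> +oo] --> 0.
Proof.
apply: (@squeeze_cvgr _ _ _ _ (fun=> 0) (fun eps => A / 4 * eps^-1)).
- near=> eps; have eps0 : 0 < eps by near: eps; exact: nbhs_pinfty_gt.
  rewrite /entropic_term; have := r1 eps; set r := Num.sqrt _ => rge1.
  have rE : r ^+ 2 = 1 + A / eps ^+ 2.
    by rewrite sqr_sqrtr// addr_ge0// divr_ge0// sqr_ge0.
  have y1 : -1 < (r - 1) / 2 by lra.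
  have := le_ln1Dx y1; rewrite (_ : 1 + (r - 1) / 2 = 2^-1 + 2^-1 * r); last by field.
  have : 0 <= ln (2^-1 + 2^-1 * r) by apply: ln_ge0; lra.
  set l := ln _ => l0 l1.
  have e20 : 0 < eps / 2 by rewrite divr_gt0.
  apply/andP; split; first by rewrite -mulrBr mulr_ge0 ?(ltW e20)// subr_ge0; lra.
  apply: (@le_trans _ _ (eps / 2 * (r - 1))).
    by rewrite gerBl mulr_ge0// ltW.
  have r2 : r - 1 <= A / eps ^+ 2 / 2 by have := sqr_ge0 (r - 1); rewrite sqrrB1 rE; lra.
  apply: le_trans (ler_wpM2l (ltW e20) r2) _.
  by rewrite le_eqVlt; apply/orP; left; apply/eqP; field; rewrite gt_eqF.
- exact: cvg_cst.
- rewrite -[X in _ --> X](mulr0 (A / 4)); apply: cvgM; first exact: cvg_cst.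
  apply/gtr0_cvgV0; last exact: cvg_id.
  by near=> eps; near: eps; exact: nbhs_pinfty_gt.
Unshelve. all: by end_near. Qed.

Lemma cvg_entropic_term_0 : entropic_term eps @[eps --> 0^'+] --> Num.sqrt A / 2.
Proof.
have c2 : {for 0, continuous (fun eps : R => eps ^+ 2 + A)}.
  by apply: cvgD; [exact: exprn_continuous|exact: cvg_cst].
have c3 : {for 0, continuous (fun eps : R => Num.sqrt (eps ^+ 2 + A))}.
  exact: continuous_sqrt_comp c2.
pose u (eps : R) := (Num.sqrt (eps ^+ 2 + A) - eps) / 2.
pose v (eps : R) := Num.sqrt (eps ^+ 2 / 2 + eps / 2 * Num.sqrt (eps ^+ 2 + A)).
have cu : u eps @[eps --> 0^'+] --> Num.sqrt A / 2.
  apply: cvg_at_right_filter.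
  rewrite (_ : Num.sqrt A / 2 = u 0); last by rewrite /u expr0n add0r subr0.
  apply: cvgM; last exact: cvg_cst.
  by apply: cvgB; [exact: c3|exact: cvg_id].
have cw : {for 0, continuous (fun eps : R => eps ^+ 2 / 2 + eps / 2 * Num.sqrt (eps ^+ 2 + A))}.
  apply: cvgD; first by apply: cvgM; [exact: exprn_continuous|exact: cvg_cst].
  by apply: cvgM; [apply: cvgM; [exact: cvg_id|exact: cvg_cst]|exact: c3].
have cv0 : {for 0, continuous v} by exact: continuous_sqrt_comp cw.
have cv : v eps @[eps --> 0^'+] --> 0.
  apply: cvg_at_right_filter.
  have v0 : v 0 = 0 by rewrite /v expr0n !mul0r add0r sqrtr0.
  by rewrite -[X in _ --> X]v0; exact: cv0.
apply: (@squeeze_cvgr _ _ _ _ (fun eps => u eps - v eps) u) => //; last first.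
  by rewrite -[X in _ --> X]subr0; apply: cvgB.
near=> eps; have eps0 : 0 < eps by near: eps; exact: nbhs_right_gt.
rewrite /entropic_term; have := r1 eps; set r := Num.sqrt _ => rge1.
have erE : eps * r = Num.sqrt (eps ^+ 2 + A).
  rewrite /r -[X in X * _ = _](ger0_norm (ltW eps0)) -sqrtr_sqr -sqrtrM ?sqr_ge0//.
  by congr Num.sqrt; field; rewrite gt_eqF.
pose y := 2^-1 + 2^-1 * r.
have y1 : 1 <= y by rewrite /y; lra.
have veE : v eps = eps * Num.sqrt y.
  rewrite /v -erE -[X in X * Num.sqrt y](ger0_norm (ltW eps0)) -sqrtr_sqr -sqrtrM ?sqr_ge0//.
  by congr Num.sqrt; rewrite /y; field.
have uE : u eps = eps / 2 * (r - 1) by rewrite /u -erE; field.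
have ly0 : 0 <= ln y by exact: ln_ge0.
have ly1 : ln y <= 2 * Num.sqrt y.
  have s0 : 0 < Num.sqrt y by rewrite sqrtr_gt0; lra.
  have yE : ln y = ln (Num.sqrt y) + ln (Num.sqrt y).
    by rewrite -lnM ?posrE// -expr2 sqr_sqrtr//; lra.
  have := @le_ln1Dx R (Num.sqrt y - 1); rewrite ltrBrDl subrr s0 addrC subrK => /(_ isT).
  by rewrite yE; lra.
have e20 : 0 < eps / 2 by rewrite divr_gt0.
rewrite -/y uE veE; apply/andP; split; last by rewrite gerBl mulr_ge0// ltW.
rewrite lerB// (le_trans (ler_wpM2l (ltW e20) ly1))//.
by rewrite mulrA divfK.
Unshelve. all: by end_near. Qed.

End entropic_term.

Lemma gram_square_spectral {R : realType} {X : Type} (K : X -> X -> R) m (x : 'I_m -> X) :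
  pd_kernel K -> (0 < m)%N ->
  let J := @centering R m in let KX := gram K x x in
  exists (U : 'M[R]_m) (l : 'rV[R]_m),
    [/\ U *m U^T = 1%:M, forall i, 0 <= l 0 i, \tr (KX *m J) = \sum_i l 0 i,
        (J *m KX *m J) ^+ 2 = U *m diag_mx (\row_i (l 0 i ^+ 2)) *m U^T
      & J *m KX *m J *m KX^T *m J = U *m diag_mx (\row_i (l 0 i ^+ 2)) *m U^T].
Proof.
move=> [Ksym Kpd] m_gt0 J KX.
have KXT : KX^T = KX by apply/matrixP => i j; rewrite !mxE Ksym.
pose G := J *m KX *m J.
have GT : G^T = G by rewrite /G !trmx_mul KXT centering_tr mulmxA.
have Gpsd : psdmx G.
  move=> v; have -> : v^T *m G *m v = (J *m v)^T *m KX *m (J *m v).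
    by rewrite trmx_mul centering_tr /G !mulmxA.
  move: (J *m v) => w; have := Kpd m x (fun i => w i 0).
  congr (_ <= _); rewrite mxE exchange_big/=; apply: eq_bigr => j _.
  rewrite mxE mulr_suml; apply: eq_bigr => i _; rewrite !mxE; ring.
have [U [l [UU GE l0]]] := symmetric_psd_spectral GT Gpsd.
have G2 : G *m G = U *m diag_mx (\row_i (l 0 i ^+ 2)) *m U^T.
  by rewrite GE mul_spectral//; congr (_ *m diag_mx _ *m _); apply/rowP => i; rewrite !mxE.
exists U, l; split=> //.
- rewrite -(mxtrace_spectral UU) -GE; apply/esym.
  by rewrite /G mxtrace_mulC mulmxA centering_idem// mxtrace_mulC.
- by rewrite -G2 KXT /G !mulmxA -(mulmxA (J *m KX) J J) centering_idem.
Qed.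

Lemma entropic_term_sum {R : realType} m (d : 'rV[R]_m) (eps : R) : 0 < eps ->
  let c := 16 / (eps ^+ 2 * m%:R ^+ 2) in
  eps / 2 * (\sum_i (Num.sqrt (1 + c * d 0 i) - 1))
  - eps / 2 * (\sum_i ln (2^-1 + 2^-1 * Num.sqrt (1 + c * d 0 i))) =
  \sum_i entropic_term (16 / m%:R ^+ 2 * d 0 i) eps.
Proof.
move=> eps0 c; rewrite !mulr_sumr -sumrN -big_split/=; apply: eq_bigr => i _.
rewrite /entropic_term (_ : 16 / m%:R ^+ 2 * d 0 i / eps ^+ 2 = c * d 0 i)//.
by rewrite /c (invfM (eps ^+ 2)); ring.
Qed.

Lemma cvg_sum_real {R : realType} {T : Type} (F : set_system T) {FF : Filter F} n
    (f : 'I_n -> T -> R) (l : 'I_n -> R) :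
  (forall i, f i x @[x --> F] --> l i) ->
  \sum_i f i x @[x --> F] --> \sum_i l i.
Proof. by move=> fl; apply: cvg_big => [|i _]; [exact: add_continuous|exact: fl]. Qed.

Unset Implicit Arguments.

Theorem mainTheorem19
  (R : realType) (X : completePseudoMetricType R)
  (HX : hausdorff_space X) (sepX : separable_space X)
  (K : X -> X -> R)
  (Kcont : continuous (fun p : X * X => K p.1 p.2)) (Kpd : pd_kernel K)
  (H : completeNormedModType R) (ip : H -> H -> R) (Phi : X -> H)
  (HK : rkhs_feature_map K ip Phi)
  (m : nat) (m_gt0 : (0 < m)%N) (x y : 'I_m -> X)
  (mu0 mu1 : probability (borel H) R)
  (Hmu0 : is_gaussian ip mu0 (emp_mean Phi x) (emp_cov ip Phi x))
  (Hmu1 : is_gaussian ip mu1 (emp_mean Phi y) (emp_cov ip Phi y)) :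
  let KX := gram K x x in
  let KY := gram K y y in
  let KXY := gram K x y in
  let KYX := KXY^T in
  let J := centering m in
  let P := J *m KXY *m J *m KYX *m J in
  let mean_term := m%:R^-2 * ones_form (KX + KY - 2%:R *: KXY) in
  let c (eps : R) := 16 / (eps ^+ 2 * m%:R ^+ 2) in
  let T (eps : R) (A : 'M[R]_m) := \tr (- 1%:M + sqrtmx (1%:M + c eps *: A)) in
  let LD (eps : R) (A : 'M[R]_m) :=
    ln (\det (2^-1 *: 1%:M + 2^-1 *: sqrtmx (1%:M + c eps *: A))) in
  (forall eps : R, 0 < eps ->
     OTeps eps mu0 mu1 =
       (mean_term + m%:R^-1 * \tr (KX *m J) + m%:R^-1 * \tr (KY *m J)
        - eps / 2 * T eps P + eps / 2 * LD eps P)%:E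
     /\
     Seps eps mu0 mu1 =
       (mean_term
        + eps / 4 * T eps ((J *m KX *m J) ^+ 2)
        + eps / 4 * T eps ((J *m KY *m J) ^+ 2)
        - eps / 2 * T eps P + eps / 2 * LD eps P
        - eps / 4 * LD eps ((J *m KX *m J) ^+ 2)
        - eps / 4 * LD eps ((J *m KY *m J) ^+ 2))%:E)
  /\
  (`|emp_mean Phi x - emp_mean Phi y| ^+ 2 = mean_term /\
   (fun eps : R => Seps eps mu0 mu1) @ +oo --> mean_term%:E)
  /\
  (fun eps : R => Seps eps mu0 mu1) @ 0^'+ -->
    (mean_term + m%:R^-1 * \tr (KX *m J) + m%:R^-1 * \tr (KY *m J)
     - 2%:R / m%:R * \tr (sqrtmx P))%:E.
Proof.
move=> KX KY KXY KYX J P mean_term c T LD.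
have m_neq0 : m%:R != 0 :> R by rewrite pnatr_eq0 -lt0n.
have meanE : `|emp_mean Phi x - emp_mean Phi y| ^+ 2 = mean_term.
  exact: (emp_mean_dist HK).
have c0 eps : 0 <= c eps by rewrite divr_ge0// mulr_ge0// sqr_ge0.
have [Ux [lx [UUx lx0 trx KX2 KXK]]] := gram_square_spectral x Kpd m_gt0.
have [Uy [ly [UUy ly0 try_ KY2 KYK]]] := gram_square_spectral y Kpd m_gt0.
have [U [d [UU PE d0]]] : exists (U : 'M[R]_m) (d : 'rV[R]_m),
    [/\ U *m U^T = 1%:M, P = U *m diag_mx d *m U^T & forall i, 0 <= d 0 i].
  have PN : P = (J *m KXY *m J) *m (J *m KXY *m J)^T.
    rewrite !trmx_mul centering_tr !mulmxA.
    by rewrite -(mulmxA (J *m KXY) J J) centering_idem.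
  apply: symmetric_psd_spectral; first by rewrite PN trmx_mul trmxK.
  by rewrite PN; exact: psdmx_gram.
pose dx : 'rV[R]_m := \row_i (lx 0 i ^+ 2); pose dy : 'rV[R]_m := \row_i (ly 0 i ^+ 2).
have dx0 i : 0 <= dx 0 i by rewrite mxE sqr_ge0.
have dy0 i : 0 <= dy 0 i by rewrite mxE sqr_ge0.
have OTxy := OTeps_empirical sepX Kcont HK m_gt0 Hmu0 Hmu1 UU d0 PE.
have OTxx := OTeps_empirical sepX Kcont HK m_gt0 Hmu0 Hmu0 UUx dx0 KXK.
have OTyy := OTeps_empirical sepX Kcont HK m_gt0 Hmu1 Hmu1 UUy dy0 KYK.
pose S (eps : R) := mean_term + 2^-1 * (\sum_i entropic_term (16 / m%:R ^+ 2 * dx 0 i) eps)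
     + 2^-1 * (\sum_i entropic_term (16 / m%:R ^+ 2 * dy 0 i) eps)
     - \sum_i entropic_term (16 / m%:R ^+ 2 * d 0 i) eps.
have SE eps : 0 < eps -> Seps eps mu0 mu1 = (S eps)%:E.
  move=> eps0; rewrite /Seps /S OTxy// OTxx// OTyy// !subrr normr0 expr0n -!entropic_term_sum//.
  by rewrite -EFinD meanE; congr EFin; rewrite /=; field.
have TE (V : 'M[R]_m) (e : 'rV[R]_m) eps : V *m V^T = 1%:M -> (forall i, 0 <= e 0 i) ->
    T eps (V *m diag_mx e *m V^T) = \sum_i (Num.sqrt (1 + c eps * e 0 i) - 1).
  by move=> VV e0; exact: mxtrace_sqrtmx_affine.
have LDE (V : 'M[R]_m) (e : 'rV[R]_m) eps : V *m V^T = 1%:M -> (forall i, 0 <= e 0 i) ->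
    LD eps (V *m diag_mx e *m V^T) = \sum_i ln (2^-1 + 2^-1 * Num.sqrt (1 + c eps * e 0 i)).
  by move=> VV e0; exact: ln_det_sqrtmx_affine.
have S_lim (F : set_system R) (FF : Filter F) (l1 l2 l3 : R) :
    \sum_i entropic_term (16 / m%:R ^+ 2 * dx 0 i) eps @[eps --> F] --> l1 ->
    \sum_i entropic_term (16 / m%:R ^+ 2 * dy 0 i) eps @[eps --> F] --> l2 ->
    \sum_i entropic_term (16 / m%:R ^+ 2 * d 0 i) eps @[eps --> F] --> l3 ->
    S eps @[eps --> F] -->
    mean_term + 2^-1 * l1 + 2^-1 * l2 - l3.
  move=> h1 h2 h3; apply: cvgB => //; apply: cvgD; [apply: cvgD; first exact: cvg_cst|];
  by apply: cvgM => //; exact: cvg_cst.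
split; [|split; [split=> //|]].
- move=> eps eps0; split.
    by rewrite OTxy// PE TE// LDE// meanE.
  rewrite SE// /S PE KX2 KY2 !TE// !LDE// -!entropic_term_sum//.
  by congr EFin; rewrite -/(c eps); field.
- have sum_cvg (e : 'rV[R]_m) : (forall i, 0 <= e 0 i) ->
      \sum_i entropic_term (16 / m%:R ^+ 2 * e 0 i) eps @[eps --> +oo] --> (0 : R).
    move=> e0; have z : \sum_(i < m) (0 : R) = 0 by rewrite big1.
    rewrite -[X in _ --> X]z.
    have A0 i : 0 <= 16 / m%:R ^+ 2 * e 0 i by rewrite mulr_ge0// divr_ge0// sqr_ge0.
    exact: (cvg_sum_real (fun i => cvg_entropic_term_pinfty (A0 i))).
  have S_cvg : S eps @[eps --> +oo] --> mean_term + 2^-1 * 0 + 2^-1 * 0 - 0.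
    by apply: S_lim; exact: sum_cvg.
  rewrite !mulr0 !addr0 subr0 in S_cvg.
  apply: cvg_EFin; first by near=> eps; rewrite SE//; near: eps; exact: nbhs_pinfty_gt.
  have S_near : \forall eps \near +oo, S eps = (fine \o (fun eps => Seps eps mu0 mu1)) eps.
    by near=> eps; rewrite /= SE//; near: eps; exact: nbhs_pinfty_gt.
  exact: cvg_trans (near_eq_cvg S_near) S_cvg.
- have sqrt16 (u : R) : Num.sqrt (16 / m%:R ^+ 2 * u) / 2 = 2 / m%:R * Num.sqrt u.
    have -> : 16 / m%:R ^+ 2 = (4 / m%:R) ^+ 2 :> R by field.
    by rewrite sqrtrM ?sqr_ge0// sqrtr_sqr ger0_norm ?divr_ge0//; field.
  have sum_cvg (e : 'rV[R]_m) : (forall i, 0 <= e 0 i) ->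
      \sum_i entropic_term (16 / m%:R ^+ 2 * e 0 i) eps @[eps --> 0^'+] -->
      2 / m%:R * \sum_i Num.sqrt (e 0 i).
    move=> e0; rewrite mulr_sumr.
    have A0 i : 0 <= 16 / m%:R ^+ 2 * e 0 i by rewrite mulr_ge0// divr_ge0// sqr_ge0.
    under eq_bigr do rewrite -sqrt16.
    exact: (cvg_sum_real (fun i => cvg_entropic_term_0 (A0 i))).
  have sqrt_sq (l : 'rV[R]_m) : (forall i, 0 <= l 0 i) ->
      \sum_i Num.sqrt ((\row_i (l 0 i ^+ 2)) 0 i) = \sum_i l 0 i.
    by move=> l0; apply: eq_bigr => i _; rewrite mxE sqrtr_sqr ger0_norm.
  have S_cvg : S eps @[eps --> 0^'+] --> mean_term
      + 2^-1 * (2 / m%:R * \sum_i Num.sqrt (dx 0 i))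
      + 2^-1 * (2 / m%:R * \sum_i Num.sqrt (dy 0 i)) - 2 / m%:R * \sum_i Num.sqrt (d 0 i).
    by apply: S_lim; exact: sum_cvg.
  rewrite sqrt_sq// sqrt_sq// -trx -try_ in S_cvg.
  have -> : \tr (sqrtmx P) = \sum_i Num.sqrt (d 0 i).
    rewrite PE sqrtmx_spectral// mxtrace_spectral//.
    by apply: eq_bigr => i _; rewrite mxE.
  have -> : m%:R^-1 * \tr (KX *m J) = 2^-1 * (2 / m%:R * \tr (KX *m J)) by field.
  have -> : m%:R^-1 * \tr (KY *m J) = 2^-1 * (2 / m%:R * \tr (KY *m J)) by field.
  apply: cvg_EFin; first by near=> eps; rewrite SE//; near: eps; exact: nbhs_right_gt.
  have S_near : \forall eps \near 0^'+, S eps = (fine \o (fun eps => Seps eps mu0 mu1)) eps.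
    by near=> eps; rewrite /= SE//; near: eps; exact: nbhs_right_gt.
  exact: cvg_trans (near_eq_cvg S_near) S_cvg.
Unshelve. all: by end_near. Qed.
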